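(* Let $\mu$ be a probability measure supported on $[0,L]$ with mean $\alpha$ and variance $\sigma^2$. Then for each $n\ge 1$ there exists a constant $N$ such that for all integers $k\ge N$, the first $n$ free cumulants $\kappa_1(\mu^{\boxtimes k}),\dots,\kappa_n(\mu^{\boxtimes k})$ of $\mu^{\boxtimes k}$ are non-negative.
   Context: Free cumulants of a compactly supported probability measure $\nu$ on $\mathbb{R}$: the real numbers $\kappa_n(\nu)$, $n\ge1$, determined recursively by $\int x^n\,d\nu=\sum_{\pi\in NC(n)}\prod_{V\in\pi}\kappa_{|V|}(\nu)$ for all $n\ge1$, where $NC(n)$ is the set of non-crossing partitions of $\{1,\dots,n\}$. Free multiplicative convolution $\boxtimes$: for compactly supported probability measures $\mu_1,\dots,\mu_k$ on $[0,\infty)$, take free positive elements $a_1,\dots,a_k$ of a tracial $C^*$-probability space $(\mathcal{A},\tau)$ with $\tau(a_i^m)=\int x^m\,d\mu_i$ for all $m$, and let $b_i$ be the positive square root of $a_i$. Then $\mu_1\boxtimes\cdots\boxtimes\mu_k$ is the distribution of $b_1b_2\cdots b_kb_k\cdots b_2b_1$, i.e. the unique compactly supported probability measure on $[0,\infty)$ with the same moments as this element; equivalently its $n$-th moment is $\tau((a_1\cdots a_k)^n)$. $\mu^{\boxtimes k}$ is $\mu\boxtimes\cdots\boxtimes\mu$ ($k$ factors). *)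

(* Defs.v *)
From HB Require Import structures.
From mathcomp Require Import all_boot all_order all_algebra.
From mathcomp Require Import complex.
From mathcomp Require Import all_classical all_reals all_analysis.

Set Implicit Arguments.
Unset Strict Implicit.
Unset Printing Implicit Defensive.

Import Order.TTheory GRing.Theory Num.Theory.
Import numFieldNormedType.Exports.

Local Open Scope ring_scope.
Local Open Scope complex_scope.

Definition noncrossing (n : nat) (P : {set {set 'I_n}}) : bool :=
  [forall V in P, forall W in P,
   forall a : 'I_n, forall b : 'I_n, forall c : 'I_n, forall d : 'I_n,
     [&& (a < b)%N, (b < c)%N, (c < d)%N,
         a \in V, c \in V, b \in W & d \in W] ==> (V == W)].

Definition NC (n : nat) : {set {set {set 'I_n}}} :=
  [set P | finset.partition P [set: 'I_n] & noncrossing P].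

(* The moment-cumulant formula
     m n = \sum_(P in NC n) \prod_(V in P) kappa #|V|,   n >= 1,
   solved for kappa n: the one-block partition contributes exactly kappa n and
   every other partition only involves kappa j with j < n. [cumulants_upto m n]
   agrees with the cumulant sequence at 1, ..., n. *)
Fixpoint cumulants_upto (R : pzRingType) (m : nat -> R) (n : nat) : nat -> R :=
  if n is n'.+1 then
    let kappa := cumulants_upto m n' in
    fun j => if (j == n'.+1)%N then
               m n'.+1 - \sum_(P in NC n'.+1 | P != [set [set: 'I_n'.+1]])
                           \prod_(V in P) kappa #|V|
             else kappa j
  else fun=> 0.

Section moments.
Context (R : realType).
Implicit Type nu : probability (measurableTypeR R) R.

Definition moment nu (n : nat) : R := (\int[nu]_x ((x : R) ^+ n))%R.

Definition supported_in nu (S : set R) : Prop := nu S = 1%E.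

Definition free_cumulant nu (n : nat) : R := cumulants_upto (moment nu) n n.

End moments.

Section moment_cumulant.
Context (R : comPzRingType) (m : nat -> R).

Lemma cumulants_upto_stable (n j : nat) :
  (j <= n)%N -> cumulants_upto m n j = cumulants_upto m j j.
Proof.
elim: n => [|n IHn]; first by rewrite leqn0 => /eqP ->.
rewrite leq_eqVlt => /predU1P[-> //|]; rewrite ltnS => jn /=.
by rewrite ltn_eqF ?ltnS// IHn.
Qed.

Lemma NC_one_block (n : nat) : [set [set: 'I_n.+1]] \in NC n.+1.
Proof.
rewrite inE; apply/andP; split.
  apply/and3P; split; first by rewrite /finset.cover big_set1.
    by apply/finset.trivIsetP => A B; rewrite !inE => /eqP -> /eqP ->; rewrite eqxx.
  by rewrite inE; apply/eqP => /setP/(_ ord0); rewrite !inE.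
apply/forall_inP => V /set1P ->; apply/forall_inP => W /set1P ->.
by do 4 (apply/forallP => ?); rewrite eqxx implybT.
Qed.

Lemma NC_small_block (n : nat) (P : {set {set 'I_n.+1}}) (V : {set 'I_n.+1}) :
  P \in NC n.+1 -> P != [set [set: 'I_n.+1]] -> V \in P -> (0 < #|V| <= n)%N.
Proof.
rewrite inE => /andP[/and3P[_ tI n0]] _ Pn1 VP.
have V0 : (0 < #|V|)%N.
  by rewrite card_gt0; apply: contraNneq n0 => <-.
rewrite V0 -ltnS ltn_neqAle -[X in (_ <= X)%N]card_ord max_card andbT.
apply: contraNneq Pn1 => cV.
have VT : V = [set: 'I_n.+1].
  by apply/eqP; rewrite eqEcard finset.subsetT cardsT card_ord cV leqnn.
rewrite -VT finset.eqEsubset finset.sub1set VP andbT; apply/fintype.subsetP => W WP.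
rewrite inE; apply: contraT => WV.
have /finset.trivIsetP/(_ W V WP VP WV) := tI.
rewrite VT -setI_eq0 finset.setIT => /eqP W0.
by rewrite -W0 WP in n0.
Qed.

Lemma moment_cumulant_split (kappa : nat -> R) (n : nat) :
  \sum_(P in NC n.+1) \prod_(V in P) kappa #|V| =
  kappa n.+1 + \sum_(P in NC n.+1 | P != [set [set: 'I_n.+1]])
                 \prod_(V in P) kappa #|V|.
Proof.
by rewrite (bigD1 _ (NC_one_block n)) /= big_set1 cardsT card_ord.
Qed.

Lemma cumulants_uptoP (n : nat) : (0 < n)%N ->
  m n = \sum_(P in NC n) \prod_(V in P) cumulants_upto m #|V| #|V|.
Proof.
case: n => // n _.
rewrite (moment_cumulant_split (fun j => cumulants_upto m j j)) /= eqxx.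
rewrite addrAC -addrA; set s1 := \sum_(_ in _ | _) _; set s2 := \sum_(_ in _ | _) _.
suff -> : s1 = s2 by rewrite subrr addr0.
apply: eq_bigr => P /andP[PN P1]; apply: eq_bigr => V VP.
have /andP[_ Vn] := NC_small_block PN P1 VP.
by rewrite (cumulants_upto_stable Vn).
Qed.

Lemma cumulants_upto_unique (kappa : nat -> R) :
  (forall n, (0 < n)%N -> m n = \sum_(P in NC n) \prod_(V in P) kappa #|V|) ->
  forall n, (0 < n)%N -> kappa n = cumulants_upto m n n.
Proof.
move=> mk; elim/ltn_ind => -[//|n] IH _.
have := mk n.+1 isT; rewrite moment_cumulant_split /= eqxx => ->.
rewrite -addrA [X in _ + X](_ : _ = 0) ?addr0//; apply/eqP; rewrite subr_eq0.
apply/eqP/eq_bigr => P /andP[PN P1]; apply: eq_bigr => V VP.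
have /andP[V0 Vn] := NC_small_block PN P1 VP.
by rewrite (cumulants_upto_stable Vn) IH.
Qed.

End moment_cumulant.

Section free_cumulant_spec.
Context (R : realType).
Implicit Type nu : probability (measurableTypeR R) R.

Lemma free_cumulantP nu (n : nat) : (0 < n)%N ->
  moment nu n = \sum_(P in NC n) \prod_(V in P) free_cumulant nu #|V|.
Proof. exact: cumulants_uptoP. Qed.

Lemma free_cumulant_unique nu (kappa : nat -> R) :
  (forall n, (0 < n)%N ->
     moment nu n = \sum_(P in NC n) \prod_(V in P) kappa #|V|) ->
  forall n, (0 < n)%N -> kappa n = free_cumulant nu n.
Proof. exact: cumulants_upto_unique. Qed.

End free_cumulant_spec.

(* The norm is a separate real-valued operation: the library has no join of
   rings with its normed modules, whose norm over R[i] is R[i]-valued. *)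
HB.mixin Record isCStarAlgebra (R : realType) A & GRing.Algebra R[i] A := {
  star : A -> A;
  cnorm : A -> R;
  starK : involutive star;
  starD : {morph star : x y / x + y};
  starZ : forall (c : R[i]) x, star (c *: x) = conjc c *: star x;
  starM : forall x y, star (x * y) = star y * star x;
  cnorm_eq0 : forall x, cnorm x = 0 -> x = 0;
  cnormZ : forall (c : R[i]) x, (cnorm (c *: x))%:C = `|c| * (cnorm x)%:C;
  ler_cnormD : forall x y, cnorm (x + y) <= cnorm x + cnorm y;
  ler_cnormM : forall x y, cnorm (x * y) <= cnorm x * cnorm y;
  cnorm_star_mul : forall x, cnorm (star x * x) = cnorm x ^+ 2;
  cnorm_complete : forall u : nat -> A,
    (forall e : R, 0 < e -> exists N : nat, forall p q : nat,
       (N <= p)%N -> (N <= q)%N -> cnorm (u p - u q) < e) ->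
    exists l : A, forall e : R, 0 < e -> exists N : nat, forall p : nat,
      (N <= p)%N -> cnorm (u p - l) < e
}.

#[short(type="cstarAlgType")]
HB.structure Definition CStarAlgebra (R : realType) :=
  {A of GRing.Algebra R[i] A & isCStarAlgebra R A}.

Section cstar.
Context (R : realType) (A : cstarAlgType R).

Definition cstar_positive (a : A) : Prop := exists c : A, a = star c * c.

(* (A, tau) is a tracial C*-probability space *)
Definition tracial_state (tau : {scalar A}) : Prop :=
  [/\ tau 1 = 1,
      (forall a, 0 <= tau (star a * a)) &
      (forall a b, tau (a * b) = tau (b * a))].

Definition free_subalgebras (tau : {scalar A}) (I : Type) (B : I -> set A) :
    Prop :=
  forall (m : nat) (i : nat -> I) (x : nat -> A),
    (0 < m)%N ->
    (forall j, (j < m)%N -> B (i j) (x j) /\ tau (x j) = 0) ->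
    (forall j, (j.+1 < m)%N -> i j <> i j.+1) ->
    tau (\prod_(j < m) x j) = 0.

(* The unital subalgebra generated by a; it is a *-subalgebra when a is
   self-adjoint, in particular when a is positive. *)
Definition gen_subalgebra (a : A) : set A := range (horner_alg a).

Definition free_elements (tau : {scalar A}) (I : Type) (a : I -> A) : Prop :=
  free_subalgebras tau (fun i => gen_subalgebra (a i)).

End cstar.

(* The convolution is a relation: nu is the distribution of
   b_0 b_1 ... b_(k-1) b_(k-1) ... b_1 b_0 for some free positive a_i with
   distributions mu i and positive square roots b_i. Such a nu always exists
   (free products of C*-probability spaces) and is unique: it has compact
   support, and its moments do not depend on the space or on the a_i. *)
Definition is_free_mult_conv (R : realType) (k : nat)
    (mu : 'I_k -> probability (measurableTypeR R) R)
    (nu : probability (measurableTypeR R) R) : Prop :=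
  (exists M : R, supported_in nu `[0, M]%classic) /\
  exists (A : cstarAlgType R) (tau : {scalar A}) (a b : 'I_k -> A),
    [/\ tracial_state tau,
        free_elements tau a,
        (forall i, cstar_positive (a i) /\
           forall m, tau (a i ^+ m) = (moment (mu i) m)%:C),
        (forall i, cstar_positive (b i) /\ b i ^+ 2 = a i) &
        forall m, (moment nu m)%:C =
          tau ((\prod_(i < k) b i * \prod_(i < k) b (rev_ord i)) ^+ m)].

Definition is_free_mult_power (R : realType)
    (mu : probability (measurableTypeR R) R) (k : nat)
    (nu : probability (measurableTypeR R) R) : Prop :=
  is_free_mult_conv (fun _ : 'I_k => mu) nu.

(* Main.v *)
Require Import Defs.
From HB Require Import structures.
From Corelib Require Setoid Morphisms.
From mathcomp Require Import all_boot all_order all_algebra.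
From mathcomp Require Import complex.
From mathcomp Require Import all_classical all_reals all_analysis.
From mathcomp Require Import measurable_realfun.
From mathcomp Require Import zify ring lra.
Import Order.TTheory GRing.Theory Num.Theory.
Import numFieldNormedType.Exports.
Local Open Scope ring_scope.

(** Let m_i and kappa_i be the moments and the free cumulants of a law, and put
    M(z) = 1 + sum m_i z^i and C(z) = 1 + sum kappa_i z^i.  Cutting a
    non-crossing partition at the block of its first point turns the
    moment-cumulant formula into M(z) = C(z M(z)) ([moment_cumulant_series]).

    If the mean is nonzero, the S-transform S is determined by
    M(z S(z) / (1 + z)) = 1 + z, and the functional equation gives
    C(z S(z)) = 1 + z.  With T = 1 / S and K = C - 1 this is K = z T(K)
    ([cumulant_S_transform], [T_transform_fixpoint]): the cumulants are computed
    one after the other from the coefficients of T by sums and products only.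
    Hence they are non-negative as soon as the coefficients of T are
    ([fixpoint_ge0]).

    The S-transform is multiplicative over free elements
    ([S_transform_mul]), so the k-th free power of mu has T-series T ^ k.  Here
    T = alpha + (sigma^2 / alpha) z + ..., and the coefficient of z^j in T ^ k is
    alpha^k times a polynomial in k with leading term
    binomial(k, j) (sigma / alpha)^(2 j), which wins for large k
    ([powers_coefs_ge0]).  This is the theorem when alpha and sigma are nonzero.
    If alpha = 0 all moments of the power vanish, and if sigma = 0 the series T
    is the constant alpha.

    Multiplicativity is Haagerup's resolvent argument.  Choose series s, t in z
    so that (1 - s a)^-1 and (1 - t b)^-1 both have trace 1 + z, and write them
    as 1 + z + z p and 1 + z + z q.  A direct computation shows that
    (1 - s a) (1 + z - z p q) (1 - t b) = 1 - r a b with r = s t (1 + z) / z.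
    Inverting the middle factor by a geometric series, every term of
    (1 - r a b)^-1 other than a scalar one is an alternating product of the
    centred p and q, so freeness gives (1 - r a b)^-1 the trace 1 + z.

    The convolution is built from the positive square roots b_i of the free
    elements a_i, and the b_i need not be polynomials in the a_i.  That the b_i
    are free as well ([free_square_roots]) follows because b_i is a limit, in the
    seminorm given by the trace, of polynomials in a_i = b_i^2
    ([square_density]); then b_1 ... b_k b_k ... b_1 is handled one letter at a
    time by traciality.

    Formal power series are represented by polynomials compared modulo a power
    of the variable. *)

Set Implicit Arguments.
Unset Strict Implicit.

(** * Non-crossing partitions and the functional equation of moments *)
(* The partitions at hand fill the context with quantified facts that only slow
   the arithmetic solver down: keep the numerical hypotheses. *)
Ltac nlia := intros; repeat match goal with
  | H : is_true (leq _ _) |- _ => revert H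
  | H : is_true (andb _ _) |- _ => revert H
  | H : is_true (negb _) |- _ => revert H
  | H : not (@eq nat _ _) |- _ => revert H
  | H : @eq nat _ _ |- _ => revert H
  | H : or _ _ |- _ => revert H
  end; clear; intros; lia.

Section NCIntervals.
Variable n : nat.
Implicit Types (i j s : nat) (q x : 'I_n) (V W : {set 'I_n}) (P Q : {set {set 'I_n}}).

Definition nat_itv i j : {set 'I_n} := [set x : 'I_n | (i <= x < j)%N].

(** Intervals are the only sets that the decomposition below produces, and keeping
    the ambient type 'I_n fixed avoids relabelling. *)
Definition NCI i j : {set {set {set 'I_n}}} :=
  [set P | finset.partition P (nat_itv i j) & noncrossing P].

(** The default value is reached for the partition of the empty interval; an empty
    root lets the recursion treat a singleton root block like the others. *)
Definition root_block i P : {set 'I_n} :=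
  odflt finset.set0 [pick V in P | [exists x in V, x == i :> nat]].

Lemma in_nat_itv i j x : (x \in nat_itv i j) = (i <= x < j)%N.
Proof. by rewrite inE. Qed.

Lemma NCIP i j P :
  P \in NCI i j <->
  [/\ forall V, V \in P -> V != finset.set0 /\ (forall x, x \in V -> (i <= x < j)%N),
      forall x, (i <= x < j)%N -> exists2 V, V \in P & x \in V,
      forall V W x, V \in P -> W \in P -> x \in V -> x \in W -> V = W &
      forall V W (a b c d : 'I_n), V \in P -> W \in P ->
        (a < b)%N -> (b < c)%N -> (c < d)%N ->
        a \in V -> c \in V -> b \in W -> d \in W -> V = W].
Proof.
rewrite inE; split.
- move=> /andP[/and3P[/eqP cP tI s0] nc]; split.
  + move=> V VP; split; first by apply: contraNneq s0 => <-.
    move=> x xV; rewrite -in_nat_itv -cP; apply/bigcupP; by exists V.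
  + move=> x; rewrite -in_nat_itv -cP => /bigcupP[V VP xV]; by exists V.
  + move=> V W x VP WP xV xW.
    by rewrite -(def_pblock tI VP xV) -(def_pblock tI WP xW).
  + move=> V W a b c d VP WP ab bc cd aV cV bW dW; apply/eqP.
    have /forall_inP/(_ _ VP)/forall_inP/(_ _ WP) := nc.
    move=> /forallP/(_ a)/forallP/(_ b)/forallP/(_ c)/forallP/(_ d)/implyP; apply.
    by rewrite ab bc cd aV cV bW dW.
- move=> [h1 h2 h3 h4]; apply/andP; split.
    apply/and3P; split.
    + apply/eqP/setP => x; rewrite in_nat_itv; apply/bigcupP/idP.
        by move=> [V VP xV]; exact: (h1 V VP).2.
      by move=> /h2[V VP xV]; exists V.
    + apply/finset.trivIsetP => V W VP WP; apply: contraR.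
      by rewrite -setI_eq0 => /set0Pn[x /setIP[xV xW]]; rewrite (h3 V W x).
    + by apply/negP => /h1[]; rewrite eqxx.
  apply/forall_inP => V VP; apply/forall_inP => W WP.
  apply/forallP => a; apply/forallP => b; apply/forallP => c; apply/forallP => d.
  apply/implyP => /and5P[ab bc cd aV /and3P[cV bW dW]].
  by apply/eqP; apply: (h4 V W a b c d).
Qed.

Lemma root_blockE i j P V x :
  P \in NCI i j -> V \in P -> x \in V -> x = i :> nat -> root_block i P = V.
Proof.
move=> /NCIP[_ _ h3 _] VP xV xi; rewrite /root_block; case: pickP => /=.
  move=> W /andP[WP /exists_inP[y yW /eqP yi]].
  have yx : y = x by apply: val_inj; rewrite /= yi xi.
  by apply: (h3 _ _ x) => //; rewrite -yx.
by move=> /(_ V)/=; rewrite VP => /negbT/negP[]; apply/existsP; exists x; rewrite xV xi/=.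
Qed.

Lemma NCIii i P : (P \in NCI i i) = (P == finset.set0).
Proof.
have i0 : nat_itv i i = finset.set0 by apply/setP => x; rewrite in_nat_itv inE; nlia.
rewrite inE i0 partition_set0 andb_idr// => /eqP ->.
by apply/forall_inP => V; rewrite inE.
Qed.

Lemma root_block0 i : root_block i finset.set0 = finset.set0.
Proof. by rewrite /root_block; case: pickP => //= V; rewrite inE. Qed.

Lemma root_blockP i j P : (i < j)%N -> (j <= n)%N -> P \in NCI i j ->
  root_block i P \in P /\ exists2 x : 'I_n, x \in root_block i P & x = i :> nat.
Proof.
move=> ij jn PN; have /NCIP[_ h2 _ _] := PN.
have i_n : (i < n)%N by nlia.
have [|V VP aV] := h2 (Ordinal i_n); first by rewrite /= leqnn.
by rewrite (root_blockE PN VP aV erefl); split=> //; exists (Ordinal i_n).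
Qed.

Lemma root_block_small i j P : (j <= n)%N -> P \in NCI i j -> (j <= i)%N ->
  root_block i P = finset.set0.
Proof.
move=> jn /NCIP[h1 _ _ _] ji; rewrite /root_block; case: pickP => //= V /andP[VP].
by move=> /exists_inP[x xV /eqP xi]; have := (h1 V VP).2 x xV; nlia.
Qed.

(** The decomposition cuts at this point: no block other than the root meets both
    [i, q) and [q + 1, j). *)
Definition is_last i q P : bool :=
  (q \in root_block i P) && [forall x in root_block i P, (x <= q)%N].

(** Adding q to the root block of a non-crossing partition of [i, q) cannot create
    a crossing, since q lies to the right of everything. *)
Definition join i q (PP : {set {set 'I_n}} * {set {set 'I_n}}) : {set {set 'I_n}} :=
  (q |: root_block i PP.1) |: (PP.1 :\ root_block i PP.1) :|: PP.2.

Definition cut i j q P : {set {set 'I_n}} * {set {set 'I_n}} :=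
  (((root_block i P :\ q) |: [set V in P | V \subset nat_itv i q]) :\ finset.set0,
   [set V in P | V \subset nat_itv q.+1 j]).

Lemma subset_nat_itv V i j : reflect (forall x, x \in V -> (i <= x < j)%N) (V \subset nat_itv i j).
Proof.
apply: (iffP fintype.subsetP) => h x /h; rewrite ?in_nat_itv//.
Qed.

(** A block meeting both sides of q would be interlaced with the root block, which
    contains i and q. *)
Lemma cut_cases i j q P V : (i < j)%N -> (j <= n)%N ->
  P \in NCI i j -> is_last i q P -> V \in P -> V != root_block i P ->
  V \subset nat_itv i q \/ V \subset nat_itv q.+1 j.
Proof.
move=> ij jn PN /andP[qR /forall_inP Rq] VP VR.
have [RP [r rR ri]] := root_blockP ij jn PN.
have /NCIP[h1 h2 h3 h4] := PN.
have [V0 Vij] := h1 V VP.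
have nq x : x \in V -> x <> q :> nat.
  by move=> xV /val_inj xq; move/eqP: VR; apply; apply: (h3 _ _ x); rewrite // xq.
have nr x : x \in V -> x <> r :> nat.
  by move=> xV /val_inj xq; move/eqP: VR; apply; apply: (h3 _ _ x); rewrite // xq.
have [/existsP[y /andP[yV yq]]|hN] := boolP [exists y, (y \in V) && (y < q)%N].
- left; apply/subset_nat_itv => x xV; have := Vij x xV; have := nq x xV; have := nr x xV.
  have [xq|] := ltnP x q; first nlia.
  move=> qx _ xq' _; exfalso; move/eqP: VR; apply; apply/esym.
  apply: (h4 _ _ r y q x RP VP) => //; have := Vij y yV; have := nr y yV; nlia.
- right; apply/subset_nat_itv => x xV; have := Vij x xV; have := nq x xV.
  have : ~~ (x < q)%N by apply: contra hN => xq; apply/existsP; exists x; rewrite xV.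
  nlia.
Qed.

Lemma is_last_mem i j q P : (i < j)%N -> (j <= n)%N ->
  P \in NCI i j -> is_last i q P -> (i <= q < j)%N.
Proof.
move=> ij jn PN /andP[qR _]; have [RP _] := root_blockP ij jn PN.
by have /NCIP[h1 _ _ _] := PN; exact: (h1 _ RP).2.
Qed.

Lemma cut_NCI i j q P : (i < j)%N -> (j <= n)%N ->
  P \in NCI i j -> is_last i q P ->
  (cut i j q P).1 \in NCI i q /\ (cut i j q P).2 \in NCI q.+1 j.
Proof.
move=> ij jn PN lq; have /andP[qR /forall_inP Rq] := lq.
have qij := is_last_mem ij jn PN lq.
have cc := cut_cases ij jn PN lq.
have [RP [r rR ri]] := root_blockP ij jn PN.
have /NCIP[h1 h2 h3 h4] := PN.
rewrite /cut /=; set R := root_block i P in qR Rq cc RP rR *.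
split; apply/NCIP; split.
- move=> V; rewrite !inE => /andP[V0 /orP[/eqP VE|/andP[VP /subset_nat_itv Vs]]]; split=> //.
  move=> x; rewrite VE !inE => /andP[/eqP xq xR]; have := Rq x xR.
  have := (h1 _ RP).2 x xR; have : x <> q :> nat by move=> /val_inj.
  nlia.
- move=> x xiq; have [|V VP xV] := h2 x; first nlia.
  have [VR|/eqP VR] := eqVneq V R.
    exists (V :\ q); last by rewrite !inE xV andbT; apply/eqP => xq; rewrite xq in xiq; nlia.
    rewrite -VR !inE eqxx orTb andbT; apply/set0Pn; exists x.
    by rewrite !inE xV andbT; apply/eqP => xq; rewrite xq in xiq; nlia.
  exists V => //; rewrite !inE VP (h1 _ VP).1/=.
  have [|->|/subset_nat_itv/(_ x xV)] := cc V VP; [exact/eqP|by rewrite orbT|nlia].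
- move=> V W x; rewrite !inE => /andP[_ VV] /andP[_ WW] xV xW.
  case/orP: VV => [/eqP VE|/andP[VP Vs]]; case/orP: WW => [/eqP WE|/andP[WP Ws]].
  + by rewrite VE.
  + move: xV; rewrite VE !inE => /andP[xq xR]; have WR : W = R by apply: (h3 _ _ x).
    by have /subset_nat_itv/(_ q) := Ws; rewrite WR => /(_ qR); nlia.
  + move: xW; rewrite WE !inE => /andP[xq xR]; have VR : V = R by apply: (h3 _ _ x).
    by have /subset_nat_itv/(_ q) := Vs; rewrite VR => /(_ qR); nlia.
  + exact: (h3 _ _ x).
- move=> V W a b c d; rewrite !inE => /andP[_ VV] /andP[_ WW] ab bc cd.
  case/orP: VV => [/eqP VE|/andP[VP Vs]]; case/orP: WW => [/eqP WE|/andP[WP Ws]].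
  + by rewrite VE WE.
  + rewrite VE !inE => /andP[_ aR] /andP[_ cR] bW dW.
    have RW : R = W by apply: (h4 _ _ a b c d).
    by have /subset_nat_itv/(_ q) := Ws; rewrite -RW => /(_ qR); nlia.
  + rewrite WE !inE => aV cV /andP[_ bR] /andP[_ dR].
    have VR : V = R by apply: (h4 _ _ a b c d).
    by have /subset_nat_itv/(_ q) := Vs; rewrite VR => /(_ qR); nlia.
  + exact: h4.
- by move=> V; rewrite inE => /andP[VP /subset_nat_itv Vs]; split=> //; case: (h1 _ VP).
- move=> x xqj; have [|V VP xV] := h2 x; first nlia.
  exists V => //; rewrite inE VP /=.
  have VR : V != R by apply/eqP => VR; have := Rq x; rewrite -VR => /(_ xV); nlia.
  by have [/subset_nat_itv/(_ x xV)|//] := cc V VP VR; nlia.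
- by move=> V W x; rewrite !inE => /andP[VP _] /andP[WP _]; exact: h3.
- by move=> V W a b c d; rewrite !inE => /andP[VP _] /andP[WP _]; exact: h4.
Qed.

Lemma root_block_cut i j q P : (i < j)%N -> (j <= n)%N ->
  P \in NCI i j -> is_last i q P ->
  root_block i (cut i j q P).1 = root_block i P :\ q.
Proof.
move=> ij jn PN lq; have [LN _] := cut_NCI ij jn PN lq.
have qij := is_last_mem ij jn PN lq.
have /andP[qR /forall_inP Rq] := lq.
have [RP [r rR ri]] := root_blockP ij jn PN.
have [iq|qi] := ltnP i q; last first.
  rewrite (root_block_small _ LN) ?(ltnW (ltn_ord q))//; apply/esym/eqP.
  rewrite -finset.subset0; apply/fintype.subsetP => x; rewrite !inE => /andP[/eqP xq xR].
  have /NCIP[h1 _ _ _] := PN; have := (h1 _ RP).2 x xR; have := Rq x xR.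
  by have : x <> q :> nat by [move=> /val_inj]; nlia.
have rRq : r \in root_block i P :\ q.
  by rewrite !inE rR andbT; apply/eqP => rq; rewrite rq in ri; nlia.
apply: (root_blockE LN _ rRq ri); rewrite !inE eqxx orTb andbT.
by apply/set0Pn; exists r.
Qed.

Lemma cutK i j q P : (i < j)%N -> (j <= n)%N ->
  P \in NCI i j -> is_last i q P -> join i q (cut i j q P) = P.
Proof.
move=> ij jn PN lq; rewrite /join root_block_cut//.
have qij := is_last_mem ij jn PN lq.
have /andP[qR /forall_inP Rq] := lq.
have [RP [r rR ri]] := root_blockP ij jn PN.
have cc := cut_cases ij jn PN lq.
have /NCIP[h1 h2 h3 h4] := PN.
set R := root_block i P in qR Rq cc RP rR *.
rewrite finset.setD1K//; apply/setP => V; rewrite !inE.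
apply/idP/idP.
  move=> /orP[/orP[/eqP ->//|]|/andP[]//].
  by move=> /and3P[/negPf -> _ /=] /andP[].
move=> VP; have [->|VR] := eqVneq V R; rewrite ?eqxx//=.
have V0 := (h1 V VP).1; rewrite V0 VP/=.
have [Vs|->] := cc V VP VR; last by rewrite orbT.
rewrite Vs orbT/= andbT; apply/orP; left; apply/eqP => VE.
have /set0Pn[x xV] := V0; move: (xV); rewrite VE !inE => /andP[_ xR].
by move/eqP: VR; apply; apply: (h3 _ _ x).
Qed.

Lemma join_NCI i j q P1 P2 : (i <= q < j)%N -> (j <= n)%N ->
  P1 \in NCI i q -> P2 \in NCI q.+1 j ->
  join i q (P1, P2) \in NCI i j.
Proof.
move=> qij jn N1 N2; rewrite /join /=.
have R1 : root_block i P1 = finset.set0 /\ (q <= i)%N \/ root_block i P1 \in P1.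
  have [iq|qi] := ltnP i q.
    by right; have [] := root_blockP iq (ltnW (ltn_ord q)) N1.
  by left; split=> //; rewrite (root_block_small _ N1)// ltnW.
have R2 x : x = i :> nat -> x \in q |: root_block i P1.
  move=> xi; rewrite !inE; have [->//|xq] := eqVneq x q; apply/orP; right.
  have iq : (i < q)%N.
    have : x <> q :> nat by [move=> /val_inj/eqP; rewrite (negPf xq)]; nlia.
  have [_ [y yR yi]] := root_blockP iq (ltnW (ltn_ord q)) N1.
  by have -> : x = y by apply: val_inj; rewrite /= xi yi.
have /NCIP[a1 a2 a3 a4] := N1; have /NCIP[b1 b2 b3 b4] := N2.
set R := root_block i P1 in R1 R2 *.
have RL x : x \in R -> (i <= x < q)%N.
  by case: R1 => [[-> _]|RP]; [rewrite inE|exact: (a1 _ RP).2].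
have inJ V : V \in (q |: R) |: (P1 :\ R) :|: P2 ->
    [\/ V = q |: R, V != R /\ V \in P1 | V \in P2].
  rewrite !inE => /orP[/orP[/eqP->|/andP[]]|]; [exact: Or31|by move=> ? ?; apply: Or32|exact: Or33].
have RV V x : V != R -> V \in P1 -> x \in V -> x \notin R.
  move=> VR VP xV; apply/negP => xR; move/eqP: VR; apply.
  by case: R1 => [[R0 _]|RP]; [move: xR; rewrite R0 inE|exact: (a3 _ _ x)].
apply/NCIP; split.
- move=> V /inJ[->|[_ VP]|VP]; split.
  + by apply/set0Pn; exists q; rewrite !inE eqxx.
  + by move=> x; rewrite !inE => /orP[/eqP ->|/RL]; nlia.
  + exact: (a1 _ VP).1.
  + by move=> x /(a1 _ VP).2; nlia.
  + exact: (b1 _ VP).1.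
  + by move=> x /(b1 _ VP).2; nlia.
- move=> x xij; have [xq|qx|/val_inj xq] := ltngtP x q.
  + have [|V VP xV] := a2 x; first nlia.
    have [VR|VR] := eqVneq V R.
      by exists (q |: R); rewrite ?finset.setU11// !inE ?eqxx// -VR xV orbT.
    by exists V => //; rewrite !inE VR VP orbT.
  + have [|V VP xV] := b2 x; first nlia.
    by exists V => //; rewrite !inE VP orbT.
  + by exists (q |: R); rewrite !inE ?eqxx// xq eqxx.
- move=> V W x /inJ[->|[VR VP]|VP] /inJ[->|[WR WP]|WP] //.
  + rewrite !inE => /orP[/eqP ->|xR xW]; first by move=> /(a1 _ WP).2; nlia.
    by have := RV _ _ WR WP xW; rewrite xR.
  + by rewrite !inE => /orP[/eqP ->|/RL xR] /(b1 _ WP).2; nlia.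
  + rewrite !inE => xV /orP[/eqP xq|xR].
      by have := (a1 _ VP).2 _ xV; rewrite xq; nlia.
    by have := RV _ _ VR VP xV; rewrite xR.
  + exact: a3.
  + by move=> /(a1 _ VP).2 ? /(b1 _ WP).2; nlia.
  + by move=> /(b1 _ VP).2; rewrite !inE => ? /orP[/eqP xq|/RL]; [subst x|]; nlia.
  + by move=> /(b1 _ VP).2 ? /(a1 _ WP).2; nlia.
  + exact: b3.
have aR (W : {set 'I_n}) (a b c : 'I_n) : W != R -> W \in P1 -> (a < b)%N -> (b < c)%N ->
   a \in W -> c \in W -> b \in R -> False.
  move=> WR WP ab bc aW cW bR.
  case: R1 => [[R0 _]|RP]; first by move: bR; rewrite R0 inE.
  have [r rR ri] : exists2 r, r \in R & r = i :> nat.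
    have [] := root_blockP _ (ltnW (ltn_ord q)) N1; last by [].
    by have := RL b bR; nlia.
  have ra : (r < a)%N.
    have := (a1 _ WP).2 a aW; have : r <> a :> nat; last nlia.
    by move=> /val_inj ra; have := RV _ _ WR WP aW; rewrite -ra rR.
  by move/eqP: WR; apply; apply/esym; apply: (a4 R W r a b c).
move=> V W a b c d /inJ[->|[VR VP]|VP] /inJ[->|[WR WP]|WP] ab bc cd //.
- move=> aV cV bW dW; exfalso.
  have dq := (a1 _ WP).2 _ dW.
  have cR : c \in R by move: cV; rewrite !inE => /orP[/eqP cq|//]; subst c; nlia.
  exact: (aR W b c d).
- move=> aV cV bW dW; exfalso.
  have := (b1 _ WP).2 _ bW; move: cV; rewrite !inE => /orP[/eqP cq|/RL]; [subst c|]; nlia.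
- move=> aV cV bW dW; exfalso.
  have cq := (a1 _ VP).2 _ cV.
  have bR : b \in R by move: bW; rewrite !inE => /orP[/eqP bq|//]; subst b; nlia.
  exact: (aR V a b c).
- exact: a4.
- by move=> _ /(a1 _ VP).2 ? /(b1 _ WP).2; nlia.
- move=> /(b1 _ VP).2 ? _; rewrite !inE => /orP[/eqP bq|/RL]; [subst b|]; nlia.
- by move=> /(b1 _ VP).2 ? _ /(a1 _ WP).2; nlia.
- exact: b4.
Qed.

Lemma root_block_join i j q P1 P2 : (i <= q < j)%N -> (j <= n)%N ->
  P1 \in NCI i q -> P2 \in NCI q.+1 j ->
  root_block i (join i q (P1, P2)) = q |: root_block i P1.
Proof.
move=> qij jn N1 N2; have JN := join_NCI qij jn N1 N2.
have JR : q |: root_block i P1 \in join i q (P1, P2) by rewrite !inE eqxx.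
have [iq|qi] := ltnP i q.
  have [_ [r rR ri]] := root_blockP iq (ltnW (ltn_ord q)) N1.
  by apply: (root_blockE JN JR _ ri); rewrite !inE rR orbT.
by apply: (root_blockE JN JR (finset.setU11 _ _)); nlia.
Qed.

Lemma join_last i j q P1 P2 : (i <= q < j)%N -> (j <= n)%N ->
  P1 \in NCI i q -> P2 \in NCI q.+1 j ->
  is_last i q (join i q (P1, P2)).
Proof.
move=> qij jn N1 N2; rewrite /is_last (root_block_join qij jn N1 N2) finset.setU11/=.
apply/forall_inP => x; rewrite !inE => /orP[/eqP ->//|].
have [iq|qi] := ltnP i q.
  have [RP _] := root_blockP iq (ltnW (ltn_ord q)) N1.
  by have /NCIP[h1 _ _ _] := N1 => /(h1 _ RP).2; nlia.
by rewrite (root_block_small _ N1) ?inE// ltnW.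
Qed.

Lemma joinK i j q P1 P2 : (i <= q < j)%N -> (j <= n)%N ->
  P1 \in NCI i q -> P2 \in NCI q.+1 j ->
  cut i j q (join i q (P1, P2)) = (P1, P2).
Proof.
move=> qij jn N1 N2; rewrite /cut (root_block_join qij jn N1 N2).
have /NCIP[a1 a2 a3 a4] := N1; have /NCIP[b1 b2 b3 b4] := N2.
have R1 : root_block i P1 = finset.set0 \/ root_block i P1 \in P1.
  have [iq|qi] := ltnP i q.
    by right; have [] := root_blockP iq (ltnW (ltn_ord q)) N1.
  by left; rewrite (root_block_small _ N1)// ltnW.
rewrite /join/=.
set R := root_block i P1 in R1 *.
have qR : q \notin R.
  case: R1 => [->|RP]; first by rewrite inE.
  by apply/negP => /(a1 _ RP).2; nlia.
rewrite finset.setU1K//; congr (_, _); apply/setP => V; rewrite !inE.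
- apply/idP/idP.
    move=> /andP[V0 /orP[/eqP VR|/andP[]]].
      by case: R1; rewrite -VR// => VE; rewrite VE eqxx in V0.
    move=> /orP[/orP[/eqP ->|/andP[]//]|VP /subset_nat_itv Vs].
      by move=> /subset_nat_itv/(_ q (finset.setU11 _ _)); nlia.
    have /set0Pn[x xV] := V0; have := Vs x xV; have := (b1 _ VP).2 x xV; nlia.
  move=> VP; rewrite (a1 _ VP).1 VP andbT/=; have [//|VR/=] := eqVneq V R.
  by rewrite orbT/=; apply/subset_nat_itv; exact: (a1 _ VP).2.
- apply/idP/idP.
    move=> /andP[/orP[/orP[/eqP ->|/andP[_ VP]]|//]].
      by move=> /subset_nat_itv/(_ q (finset.setU11 _ _)); nlia.
    have [/set0Pn[x xV] Vs] := a1 _ VP => /subset_nat_itv/(_ x xV).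
    by have := Vs x xV; nlia.
  by move=> VP; rewrite VP orbT/=; apply/subset_nat_itv; exact: (b1 _ VP).2.
Qed.

Section weights.
Variables (K : comPzRingType) (kappa : nat -> K).

Definition ncsum i j : K := \sum_(P in NCI i j) \prod_(V in P) kappa #|V|.

(** The cumulant of the root block is shifted by s, to record points already
    removed from that block. *)
Definition ncsum_root s i j : K := \sum_(P in NCI i j)
  (kappa (s + #|root_block i P|) * \prod_(V in P :\ root_block i P) kappa #|V|).

Lemma ncsum_rootii s i : ncsum_root s i i = kappa s.
Proof.
rewrite /ncsum_root (eq_bigl (pred1 finset.set0)); last by move=> P; rewrite /= NCIii.
rewrite big_pred1_eq root_block0 cards0 addn0 big1 ?mulr1// => V.
by rewrite !inE andbF.
Qed.

Lemma ncsumii i : ncsum i i = 1.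
Proof.
rewrite /ncsum (eq_bigl (pred1 finset.set0)); last by move=> P; rewrite /= NCIii.
by rewrite big_pred1_eq big_set0.
Qed.

Lemma ncsumE i j : (i < j)%N -> (j <= n)%N -> ncsum i j = ncsum_root 0 i j.
Proof.
move=> ij jn; apply: eq_bigr => P PN; have [RP _] := root_blockP ij jn PN.
by rewrite (big_setD1 _ RP).
Qed.

Lemma weight_join s i j q P1 P2 : (i <= q < j)%N -> (j <= n)%N ->
  P1 \in NCI i q -> P2 \in NCI q.+1 j ->
  let P := join i q (P1, P2) in
  kappa (s + #|root_block i P|) * \prod_(V in P :\ root_block i P) kappa #|V| =
  kappa (s.+1 + #|root_block i P1|) *
    \prod_(V in P1 :\ root_block i P1) kappa #|V| * \prod_(V in P2) kappa #|V|.
Proof.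
move=> qij jn N1 N2 /=; rewrite (root_block_join qij jn N1 N2).
have /NCIP[a1 a2 a3 a4] := N1; have /NCIP[b1 b2 b3 b4] := N2.
have R1 : root_block i P1 = finset.set0 \/ root_block i P1 \in P1.
  have [iq|qi] := ltnP i q.
    by right; have [] := root_blockP iq (ltnW (ltn_ord q)) N1.
  by left; rewrite (root_block_small _ N1)// ltnW.
rewrite /join/=.
set R := root_block i P1 in R1 *.
have qR : q \notin R.
  case: R1 => [->|RP]; first by rewrite inE.
  by apply/negP => /(a1 _ RP).2; nlia.
rewrite finset.cardsU1 qR/= addnA addn1 -mulrA; congr (_ * _).
have -> : ((q |: R) |: P1 :\ R :|: P2) :\ (q |: R) = P1 :\ R :|: P2.
  rewrite -finset.setUA finset.setU1K// !inE negb_or; apply/andP; split.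
    by apply/negP => /andP[_ /a1[_ /(_ q (finset.setU11 _ _))]]; nlia.
  by apply/negP => /b1[_ /(_ q (finset.setU11 _ _))]; nlia.
rewrite (eq_bigl [predU (P1 :\ R) & P2]); last by move=> V; rewrite !inE.
rewrite bigU//= finset.disjoints_subset; apply/fintype.subsetP => V; rewrite !inE.
move=> /andP[_ VP]; apply/negP => VP2; have [/set0Pn[x xV] h] := a1 _ VP.
by have := h x xV; have := (b1 _ VP2).2 x xV; nlia.
Qed.

(** Partitions are sorted by the last point q of the root block; [join] and [cut]
    are inverse bijections, and removing q raises the shift by one. *)
Lemma ncsum_root_rec_ord s i j : (i < j)%N -> (j <= n)%N ->
  ncsum_root s i j =
  \sum_(q < n | (i <= q < j)%N) ncsum_root s.+1 i q * ncsum q.+1 j.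
Proof.
move=> ij jn; pose i0 := Ordinal (leq_trans ij jn).
(* The default i0 is the first point, which lies in every root block. *)
pose lst P := [arg max_(x > i0 in root_block i P) (x : nat)].
have lstP P q : P \in NCI i j -> (lst P == q) = is_last i q P.
  move=> PN; have [_ [r rR ri]] := root_blockP ij jn PN.
  have ri0 : r = i0 by apply: val_inj.
  rewrite /lst; case: arg_maxnP => [|x xR xm]; first by rewrite -ri0.
  apply/eqP/idP => [<-|/andP[qR /forall_inP qm]].
    by apply/andP; split=> //; apply/forall_inP => y /xm.
  apply: val_inj; apply/eqP; rewrite eqn_leq (qm _ xR) andTb; exact: xm.
rewrite /ncsum_root (partition_big lst (fun q : 'I_n => (i <= q < j)%N)) /=; last first.
  by move=> P PN; apply: (is_last_mem ij jn PN); rewrite -lstP.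
apply: eq_bigr => q qij.
rewrite (reindex_onto (join i q) (cut i j q)) /=; last first.
  by move=> P /andP[PN]; rewrite lstP// => lq; rewrite cutK.
rewrite (eq_bigl (fun PP => (PP.1 \in NCI i q) && (PP.2 \in NCI q.+1 j))).
  rewrite -(pair_big (mem (NCI i q)) (mem (NCI q.+1 j)) (fun P1 P2 =>
    kappa (s + #|root_block i (join i q (P1, P2))|) *
    \prod_(V in join i q (P1, P2) :\ root_block i (join i q (P1, P2))) kappa #|V|)) /=.
  rewrite /ncsum mulr_suml; apply: eq_bigr => P1 N1.
  rewrite mulr_sumr; apply: eq_bigr => P2 N2.
  by rewrite (weight_join _ qij jn N1 N2).
move=> [P1 P2] /=; apply/idP/idP.
  move=> /andP[/andP[JN]]; rewrite lstP// => lq /eqP cE.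
  by have [] := cut_NCI ij jn JN lq; rewrite cE /= => -> ->.
move=> /andP[N1 N2]; have JN := join_NCI qij jn N1 N2.
by rewrite JN lstP// (join_last qij jn N1 N2) (joinK qij jn N1 N2) eqxx.
Qed.

Lemma ncsum_root_rec s i j : (i < j)%N -> (j <= n)%N ->
  ncsum_root s i j = \sum_(i <= l < j) ncsum_root s.+1 i l * ncsum l.+1 j.
Proof.
move=> ij jn; rewrite ncsum_root_rec_ord//.
rewrite -(big_mkord (fun l => i <= l < j)%N
  (fun l => ncsum_root s.+1 i l * ncsum l.+1 j)).
rewrite (big_nat_widen i j n)// (big_nat_widenl i 0)//.
by apply: eq_bigl => l; rewrite andbC.
Qed.

End weights.
End NCIntervals.

Section MomentSeries.
Variables (K : comNzRingType) (kappa : nat -> K).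
Hypothesis kappa0 : kappa 0 = 1.

(** The recursion only involves lengths of intervals, so the sums depend neither on
    the position of the interval nor on the ambient type. *)
Lemma ncsum_root_shift N n s i j : (i <= j <= n)%N -> (j - i <= N)%N ->
  @ncsum_root n K kappa s i j = @ncsum_root N K kappa s 0 (j - i).
Proof.
have [m] := ubnP (j - i); elim: m n s i j => // m IHm n s i j jim ijn jiN.
have [ji|ij] := leqP j i.
  by have -> : j = i by [lia]; rewrite subnn !ncsum_rootii.
rewrite ncsum_root_rec ?[RHS]ncsum_root_rec; try lia.
rewrite -{1}(add0n i) big_addn; apply: eq_big_nat => q qji.
rewrite (IHm _ _ _ (q + i)%N) ?addnK; try lia; congr (_ * _).
have [qj|qj] := eqVneq (q + i).+1 j.
  have -> : (j - i)%N = q.+1 by lia.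
  by rewrite qj !ncsumii.
rewrite !ncsumE; try lia.
rewrite (IHm n _ (q + i).+1 j); try lia.
rewrite (IHm N _ q.+1 (j - i)%N); try lia.
by have -> : (j - (q + i).+1 = j - i - q.+1)%N by lia.
Qed.

Lemma ncsum_shift N n i j : (i <= j <= n)%N -> (j - i <= N)%N ->
  @ncsum n K kappa i j = @ncsum_root N K kappa 0 0 (j - i).
Proof.
move=> ijn jiN; have [ji|ij] := leqP j i.
  by have -> : j = i by [lia]; rewrite subnn ncsumii ncsum_rootii kappa0.
rewrite ncsumE; [|lia|lia].
by rewrite (ncsum_root_shift 0 ijn jiN).
Qed.

Lemma NC_sumE n : \sum_(P in NC n) \prod_(V in P) kappa #|V| = @ncsum n K kappa 0 n.
Proof.
apply: eq_bigl => P; rewrite !inE; congr (finset.partition _ _ && _).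
by apply/setP => x; rewrite in_nat_itv inE ltn_ord.
Qed.

End MomentSeries.

(** * Truncated power series *)
Section TruncatedSeries.
Variable A : nzRingType.
Implicit Types (p q r u : {poly A}) (n i : nat).

Definition eqX n p q := forall i, (i < n)%N -> p`_i = q`_i.

Lemma eqX_refl n p : eqX n p p. Proof. by []. Qed.

Lemma eqX_sym n p q : eqX n p q -> eqX n q p.
Proof. by move=> h i /h. Qed.

Lemma eqX_trans n p q r : eqX n p q -> eqX n q r -> eqX n p r.
Proof. by move=> h1 h2 i ilt; rewrite h1// h2. Qed.

Lemma eqXW m n p q : (m <= n)%N -> eqX n p q -> eqX m p q.
Proof. by move=> mn h i im; apply: h; apply: leq_trans mn. Qed.

Lemma eqXD n p p' q q' : eqX n p p' -> eqX n q q' -> eqX n (p + q) (p' + q').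
Proof. by move=> h1 h2 i il; rewrite !coefD h1// h2. Qed.

Lemma eqXN n p p' : eqX n p p' -> eqX n (- p) (- p').
Proof. by move=> h1 i il; rewrite !coefN h1. Qed.

Lemma eqXM n p p' q q' : eqX n p p' -> eqX n q q' -> eqX n (p * q) (p' * q').
Proof.
move=> h1 h2 i il; rewrite !coefM; apply: eq_bigr => j _.
by rewrite h1 ?h2//; have := ltn_ord j; lia.
Qed.

Lemma eqX_exp n p p' k : eqX n p p' -> eqX n (p ^+ k) (p' ^+ k).
Proof. by move=> h; elim: k => // k IHk; rewrite !exprS; exact: eqXM. Qed.

Lemma eqX_sum n (I : Type) (s : seq I) (P : pred I) (F G : I -> {poly A}) :
  (forall k, P k -> eqX n (F k) (G k)) ->
  eqX n (\sum_(i <- s | P i) F i) (\sum_(i <- s | P i) G i).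
Proof. by move=> h; apply: big_ind2 => // *; exact: eqXD. Qed.

Lemma eqX_XM n p q : eqX n p q -> eqX n.+1 ('X * p) ('X * q).
Proof. by move=> h [|i]; rewrite !coefXM//= ltnS => /h. Qed.

Lemma eqX_XMI n p q : eqX n.+1 ('X * p) ('X * q) -> eqX n p q.
Proof. by move=> h i il; have := h i.+1 il; rewrite !coefXM. Qed.

Lemma eqXXn n k p : (n <= k)%N -> eqX n ('X^k * p) 0.
Proof. by move=> nk i il; rewrite coefXnM coef0 (leq_trans il nk). Qed.

Lemma poly_XM p : p`_0 = 0 -> exists q, p = 'X * q.
Proof.
move=> p0; exists (drop_poly 1 p); rewrite -commr_polyX -[LHS](poly_take_drop 1) expr1.
suff -> : take_poly 1 p = 0 by rewrite add0r.
by apply/polyP => -[|i]; rewrite coef_take_poly coef0//=.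
Qed.

Lemma eqX_mulX n u p q : u`_0 = 0 -> eqX n p q -> eqX n.+1 (u * p) (u * q).
Proof. by move=> /poly_XM[v ->] pq; rewrite -!mulrA; apply: eqX_XM; apply: eqXM. Qed.

Lemma eqX_mulXr n u p q : u`_0 = 0 -> eqX n p q -> eqX n.+1 (p * u) (q * u).
Proof.
move=> /poly_XM[v ->] pq; rewrite !mulrA !commr_polyX -!mulrA.
by apply: eqX_XM; apply: eqXM.
Qed.

End TruncatedSeries.

#[global] Instance eqX_Equivalence (A : nzRingType) n : RelationClasses.Equivalence (@eqX A n).
Proof.
split; [exact: eqX_refl|exact: eqX_sym|exact: eqX_trans].
Qed.
#[global] Instance eqX_D (A : nzRingType) n :
  Morphisms.Proper (Morphisms.respectful (@eqX A n) (Morphisms.respectful (@eqX A n) (@eqX A n))) +%R.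
Proof. by move=> p p' h q q' h'; exact: eqXD. Qed.
#[global] Instance eqX_M (A : nzRingType) n :
  Morphisms.Proper (Morphisms.respectful (@eqX A n) (Morphisms.respectful (@eqX A n) (@eqX A n))) *%R.
Proof. by move=> p p' h q q' h'; exact: eqXM. Qed.
#[global] Instance eqX_N (A : nzRingType) n :
  Morphisms.Proper (Morphisms.respectful (@eqX A n) (@eqX A n)) -%R.
Proof. by move=> p p' h; exact: eqXN. Qed.

Notation "p =X_ n q" := (eqX n p q) (at level 70, n at level 2,
  format "p  =X_ n  q").

Section Composition.
Variable K : comNzRingType.
Implicit Types (p q r u v : {poly K}) (n i : nat).

Lemma eqX_exp0 n u k : u`_0 = 0 -> (n <= k)%N -> u ^+ k =X_n 0.
Proof. by move=> /poly_XM[v ->] nk; rewrite exprMn; exact: eqXXn. Qed.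

Lemma eqX_compl n p q u : u`_0 = 0 -> p =X_n q -> p \Po u =X_n q \Po u.
Proof.
move=> u0 pq; have -> : p = q + drop_poly n (p - q) * 'X^n.
  rewrite -[LHS](subrK q) -{1}(poly_take_drop n (p - q)) addrC.
  suff -> : take_poly n (p - q) = 0 by rewrite add0r.
  apply/polyP => i; rewrite coef_take_poly coef0 coefB; case: ltnP => // /pq ->.
  by rewrite subrr.
rewrite comp_polyD comp_polyM comp_Xn_poly.
by rewrite (eqX_exp0 u0 (leqnn n)) mulr0 addr0.
Qed.

(** Since u has no constant term, the powers u ^ i with i >= n do not contribute
    below degree n. *)
Lemma comp_trunc n p u : u`_0 = 0 ->
  p \Po u =X_n \sum_(i < n) p`_i *: u ^+ i.
Proof.
move=> u0; have pt : p =X_n \poly_(i < n) p`_i.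
  by move=> i il; rewrite coef_poly il.
rewrite (eqX_compl u0 pt) poly_def linear_sum.
by apply: eqX_sum => i _; rewrite /= comp_polyZ comp_Xn_poly.
Qed.

Lemma eqX_comp n p q u v : u`_0 = 0 -> v`_0 = 0 -> p =X_n q -> u =X_n v ->
  p \Po u =X_n q \Po v.
Proof.
move=> u0 v0 pq uv; rewrite (eqX_compl u0 pq) !comp_trunc//.
by apply: eqX_sum => i _; rewrite -!mul_polyC (eqX_exp i uv).
Qed.

Lemma coef0_comp p u : u`_0 = 0 -> (p \Po u)`_0 = p`_0.
Proof.
move=> u0; rewrite (comp_trunc (n := 1) p u0)// big_ord1 expr0 coefZ coefC/=.
by rewrite mulr1.
Qed.

Lemma coef1_comp p u : u`_0 = 0 -> (p \Po u)`_1 = p`_1 * u`_1.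
Proof.
move=> u0; rewrite (comp_trunc (n := 2) p u0)// !big_ord_recr big_ord0 /=.
by rewrite expr0 expr1 !coefD !coefZ coef0 coefC/= mulr0 !add0r.
Qed.

Lemma coef2_comp p u : u`_0 = 0 ->
  (p \Po u)`_2 = p`_1 * u`_2 + p`_2 * u`_1 ^+ 2.
Proof.
move=> u0; rewrite (comp_trunc (n := 3) p u0)// !big_ord_recr big_ord0 /=.
rewrite expr0 expr1 !coefD !coefZ coef0 coefC/= mulr0 !add0r.
by rewrite expr2 coefM !big_ord_recr big_ord0 /= u0 mul0r mulr0 add0r addr0 add0r.
Qed.

(** Changing u in degree n + 1 changes p(u) in that degree through the linear
    coefficient of p only: the step of Newton's construction of an inverse. *)
Lemma comp_bump n p u (c : K) : u`_0 = 0 ->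
  p \Po (u + c *: 'X^(n.+1)) =X_n.+2 p \Po u + (p`_1 * c) *: 'X^(n.+1).
Proof.
move=> u0; set h := c *: 'X^(n.+1).
have h0 : h`_0 = 0 by rewrite coefZ coefXn mulr0.
have uh0 : (u + h)`_0 = 0 by rewrite coefD u0 h0 addr0.
have [q qE] : exists q, p = (p`_0)%:P + 'X * q.
  have [|q qE] := @poly_XM _ (p - (p`_0)%:P); first by rewrite coefB coefC subrr.
  by exists q; rewrite -qE addrC subrK.
have uhu : u + h =X_n.+1 u.
  by move=> i il; rewrite coefD coefZ coefXn ltn_eqF// mulr0 addr0.
have quh := eqX_comp uh0 u0 (eqX_refl (n := n.+1) q) uhu.
rewrite qE !comp_polyD !comp_polyM !comp_polyC !comp_polyX -qE mulrDl addrA.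
have -> : u * (q \Po (u + h)) =X_n.+2 u * (q \Po u).
  exact: eqX_mulX.
apply: eqXD => //.
have -> : p`_1 = q`_0 by rewrite qE coefD coefC coefXM add0r.
rewrite /h -scalerAl => i; rewrite !coefZ coefXnM coefXn ltnS.
case: ltngtP => [_|//|->] _; first by rewrite !mulr0.
by rewrite subnn coef0_comp// mulr1 mulrC.
Qed.

End Composition.

Section Inverses.
Variable K : fieldType.
Implicit Types (p q r u v : {poly K}) (n i : nat).

Lemma mul_inverse n p : p`_0 != 0 -> exists q, p * q =X_n 1.
Proof.
move=> p0; pose w := 1 - (p`_0)^-1 *: p.
have w0 : w`_0 = 0 by rewrite coefB coefZ coefC/= mulVf// subrr.
exists ((p`_0)^-1 *: \sum_(i < n) w ^+ i).
rewrite -scalerAr scalerAl.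
have -> : (p`_0)^-1 *: p = - (w - 1) by rewrite /w; ring.
by rewrite mulNr -subrX1 (eqX_exp0 w0 (leqnn n)) sub0r opprK.
Qed.

Lemma comp_right_inverse n p : p`_1 != 0 ->
  exists v, p \Po ('X * v) =X_n.+1 (p`_0)%:P + 'X.
Proof.
move=> p1; elim: n => [|n [v IHv]].
  exists 0 => -[|//] _; rewrite mulr0 coef0_comp ?coef0//.
  by rewrite coefD coefC coefX addr0.
have [d dE] : exists d, d = ((p`_0)%:P + 'X)`_n.+1 - (p \Po ('X * v))`_n.+1.
  by eexists.
pose c := d / p`_1.
have u0 : ('X * v)`_0 = 0 by rewrite coefXM.
exists (v + c *: 'X^n); rewrite mulrDr -scalerAr -exprS comp_bump//.
have -> : p`_1 * c = d.
  by rewrite /c mulrC divfK.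
move=> i; rewrite ltnS leq_eqVlt => /predU1P[->|il].
  by rewrite coefD coefZ coefXn eqxx mulr1 dE addrC subrK.
by rewrite coefD coefZ coefXn ltn_eqF// mulr0 addr0 IHv.
Qed.

(** The lowest nonzero coefficient of p would survive in p(u), multiplied by a power
    of the linear coefficient of u. *)
Lemma comp_cancel n p u : u`_0 = 0 -> u`_1 != 0 ->
  p \Po u =X_n 0 -> p =X_n 0.
Proof.
move=> u0 u1 pu; elim/ltn_ind => i IHi il; rewrite coef0.
have pE : p =X_i.+1 p`_i *: 'X^i.
  move=> j; rewrite ltnS leq_eqVlt => /predU1P[->|ji].
    by rewrite coefZ coefXn eqxx mulr1.
  by rewrite (IHi j ji (ltn_trans ji il)) coef0 coefZ coefXn ltn_eqF// mulr0.
have := pu i il; rewrite coef0 (eqX_compl u0 pE)// comp_polyZ comp_Xn_poly.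
have [v vE] := poly_XM u0; rewrite vE exprMn coefZ coefXnM ltnn subnn => /eqP.
have v0 : v`_0 != 0 by move: u1; rewrite vE coefXM.
have vi k : (v ^+ k)`_0 = v`_0 ^+ k by rewrite -!horner_coef0 horner_exp.
by rewrite mulf_eq0 vi expf_eq0 (negPf v0) andbF orbF => /eqP.
Qed.

End Inverses.

Section MomentSeries2.
Variables (K : comNzRingType).

Definition series (N : nat) (m : nat -> K) : {poly K} := \poly_(i < N.+1) m i.

(** Let G_s be the generating series of the sums with shift s.  The recursion on the
    last point of the root block reads G_s = kappa_s + z G_(s+1) G_0; iterating
    it, G_0 = sum kappa_s (z G_0)^s, and G_0 is the moment series. *)
Lemma moment_cumulant_series N (m kappa : nat -> K) :
  m 0 = 1 -> kappa 0 = 1 ->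
  (forall n, (0 < n)%N -> m n = \sum_(P in NC n) \prod_(V in P) kappa #|V|) ->
  series N m =X_N.+1 series N kappa \Po ('X * series N m).
Proof.
move=> m0 k0 mE; pose G s := series N (@ncsum_root N K kappa s 0).
have mG : series N m = G 0.
  apply/polyP => i; rewrite !coef_poly; case: ltnP => //; rewrite ltnS => iN.
  case: i iN => [|i] iN; first by rewrite m0 ncsum_rootii.
  by rewrite mE// NC_sumE (ncsum_shift (N := N) k0) ?subn0 ?leqnn.
have Grec s : G s =X_N.+1 (kappa s)%:P + 'X * G 0 * G s.+1.
  have -> : 'X * G 0 * G s.+1 = 'X * (G s.+1 * G 0) by rewrite -mulrA [G 0 * _]mulrC.
  move=> i iN; rewrite coefD coefXM coefC {1}/G coef_poly iN.
  case: i iN => [|i] iN /=; first by rewrite ncsum_rootii addr0.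
  rewrite add0r ncsum_root_rec// big_mkord coefM; apply: eq_bigr => l _.
  rewrite !coef_poly ifT; last by have := ltn_ord l; lia.
  rewrite ifT; last by have := ltn_ord l; lia.
  rewrite (ncsum_shift (N := N) k0) ?subSS//; have := ltn_ord l; lia.
have Giter t s : G s =X_N.+1
    \sum_(i < t) (kappa (s + i)%N)%:P * ('X * G 0) ^+ i + ('X * G 0) ^+ t * G (s + t)%N.
  elim: t => [|t IHt]; first by rewrite big_ord0 add0r expr0 mul1r addn0.
  rewrite IHt (Grec (s + t)%N) big_ord_recr /= -addrA; apply: eqXD => //.
  by rewrite mulrDr mulrC exprSr -!mulrA addnS.
have XG0 : ('X * G 0)`_0 = 0 by rewrite coefXM.
rewrite mG {1}(Giter N.+1 0) (eqX_exp0 XG0 (leqnn _)) mul0r addr0.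
rewrite /series poly_def linear_sum; apply: eqX_sum => i _ /=.
by rewrite comp_polyZ comp_Xn_poly mul_polyC.
Qed.

End MomentSeries2.

(** * S-transform *)
Section STransform.
Variable K : fieldType.
Implicit Types (p q r u v S T sg C : {poly K}) (n i : nat).

(** The equation M(z S(z) / (1 + z)) = 1 + z up to degree N; the witness stands for
    S(z) / (1 + z). *)
Definition S_transform N (m : nat -> K) S : Prop :=
  exists2 sg, (1 + 'X) * sg = S & series N m \Po ('X * sg) =X_N.+1 1 + 'X.

Lemma S_transform_exists N (m : nat -> K) : m 0 = 1 -> m 1 != 0 ->
  exists S, S_transform N.+1 m S.
Proof.
move=> m0 m1; have [|sg sgE] := @comp_right_inverse _ N.+1 (series N.+1 m).
  by rewrite coef_poly.
exists ((1 + 'X) * sg), sg => //; rewrite sgE coef_poly/= m0.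
by rewrite polyC1.
Qed.

Lemma S_transform_coef N (m : nat -> K) S : m 0 = 1 -> S_transform N.+2 m S ->
  m 1 * S`_0 = 1 /\ m 1 ^+ 3 * S`_1 = m 1 ^+ 2 - m 2.
Proof.
move=> m0 [sg <- sgE]; have u0 : ('X * sg)`_0 = 0 by rewrite coefXM.
have c1 : m 1 * sg`_0 = 1.
  have := sgE 1%N isT; rewrite coef1_comp// coef_poly/= coefXM/= => ->.
  by rewrite coefD coefC coefX add0r.
have c2 : m 1 * sg`_1 + m 2 * sg`_0 ^+ 2 = 0.
  have := sgE 2%N isT; rewrite coef2_comp// !coef_poly/= !coefXM/= => ->.
  by rewrite coefD coefC coefX add0r.
rewrite mulrDl mul1r !coefD !coefXM/= addr0; split=> //.
have -> : m 1 ^+ 3 * (sg`_1 + sg`_0) = m 1 ^+ 2 * (m 1 * sg`_1) + m 1 ^+ 2 * (m 1 * sg`_0).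
  by ring.
rewrite (_ : m 1 * sg`_1 = - (m 2 * sg`_0 ^+ 2)); last by apply/eqP; rewrite -addr_eq0 c2.
rewrite c1 mulr1 (_ : m 1 ^+ 2 * - (m 2 * sg`_0 ^+ 2) = - (m 2 * (m 1 * sg`_0) ^+ 2)).
  by rewrite c1 expr1n mulr1 addrC.
by ring.
Qed.

(** Substitute z := w S(w) / (1 + w) in M(z) = C(z M(z)): the argument of C becomes
    w S(w), because M takes the value 1 + w. *)
Lemma cumulant_S_transform N (m kappa : nat -> K) S :
  m 0 = 1 -> kappa 0 = 1 ->
  (forall n, (0 < n)%N -> m n = \sum_(P in NC n) \prod_(V in P) kappa #|V|) ->
  S_transform N m S -> series N kappa \Po ('X * S) =X_N.+1 1 + 'X.
Proof.
move=> m0 k0 mE [sg <- sgE].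
have u0 : ('X * sg)`_0 = 0 by rewrite coefXM.
have F := moment_cumulant_series (N := N) m0 k0 mE.
have := eqX_compl u0 F; rewrite sgE -comp_polyA comp_polyM comp_polyX => FE.
rewrite -> FE; apply: eqX_comp => //.
- by rewrite coefXM.
- by rewrite -mulrA coefXM.
- by rewrite sgE [X in 'X * X]mulrC mulrA.
Qed.

(** A right inverse for composition is a left inverse: composing (z S)(C) - z with
    z S on the right gives 0, and such a composition can be cancelled.  Then
    C S(C) = z is multiplied by T(C). *)
Lemma T_transform_fixpoint N C S T : C`_0 = 0 -> S`_0 != 0 ->
  S * T =X_N.+1 1 -> C \Po ('X * S) =X_N.+1 'X -> C =X_N.+1 'X * (T \Po C).
Proof.
move=> C0 S0 ST CS.
have u0 : ('X * S)`_0 = 0 by rewrite coefXM.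
have u1 : ('X * S)`_1 != 0 by rewrite coefXM.
have SC : ('X * S) \Po C =X_N.+1 'X.
  have h : ('X * S) \Po C - 'X =X_N.+1 0.
    apply: (comp_cancel u0 u1); rewrite comp_polyB comp_polyX -comp_polyA.
    have CS0 : (C \Po ('X * S))`_0 = 0 by rewrite coef0_comp.
    have X0 : ('X : {poly K})`_0 = 0 by rewrite coefX.
    have e := eqX_comp CS0 X0 (eqX_refl (n := N.+1) ('X * S)) CS.
    by rewrite e comp_polyXr subrr.
  by rewrite -[_ \Po C](subrK 'X) h add0r.
have STC : (S \Po C) * (T \Po C) =X_N.+1 1.
  by rewrite -comp_polyM (eqX_compl C0 ST) comp_polyC.
rewrite -[X in X =X_ _ _]mulr1 -STC mulrA; apply: eqXM => //.
by rewrite -SC comp_polyM comp_polyX.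
Qed.

End STransform.

Local Open Scope complex_scope.

(** * Alternating words and freeness *)
Section LinearSpan.
Variables (F : fieldType) (A : algType F).
Implicit Types (W : A -> Prop) (x y : A).

(** An inductive span of a Prop-valued family makes bilinear extension an
    induction; see [lspanM]. *)
Inductive lspan W : A -> Prop :=
| lspan0 : lspan W 0
| lspanS c x y : W x -> lspan W y -> lspan W (c *: x + y).

Lemma lspan_base W x : W x -> lspan W x.
Proof. by move=> Wx; rewrite -[x]addr0 -[x]scale1r; apply: lspanS => //; exact: lspan0. Qed.

Lemma lspanD W x y : lspan W x -> lspan W y -> lspan W (x + y).
Proof.
move=> h hy; elim: h => [|c x' y' Wx _ IH]; first by rewrite add0r.
by rewrite -addrA; exact: lspanS.
Qed.

Lemma lspanZ W c x : lspan W x -> lspan W (c *: x).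
Proof.
elim=> [|d x' y' Wx _ IH]; first by rewrite scaler0; exact: lspan0.
by rewrite scalerDr scalerA; exact: lspanS.
Qed.

Lemma lspan_sum W (I : Type) (s : seq I) (f : I -> A) :
  (forall i, lspan W (f i)) -> lspan W (\sum_(i <- s) f i).
Proof. by move=> h; apply: big_ind => //; [exact: lspan0|exact: lspanD]. Qed.

Lemma lspan_sub W W' x : (forall y, W y -> lspan W' y) -> lspan W x -> lspan W' x.
Proof.
move=> h; elim=> [|c x' y' Wx _ IH]; first exact: lspan0.
by apply: lspanD => //; apply: lspanZ; exact: h.
Qed.

Lemma lspanM W1 W2 W3 x y : (forall u v, W1 u -> W2 v -> lspan W3 (u * v)) ->
  lspan W1 x -> lspan W2 y -> lspan W3 (x * y).
Proof.
move=> h; elim=> [|c x' y' Wx _ IH] hy; first by rewrite mul0r; exact: lspan0.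
rewrite mulrDl -scalerAl; apply: lspanD; last exact: IH.
apply: lspanZ; elim: hy => [|d u v Wu _ IHu]; first by rewrite mulr0; exact: lspan0.
by rewrite mulrDr -scalerAr; apply: lspanD => //; apply: lspanZ; exact: h.
Qed.

Lemma lspan_ker (tau : {scalar A}) W x :
  (forall y, W y -> tau y = 0) -> lspan W x -> tau x = 0.
Proof.
move=> h; elim=> [|c x' y' Wx _ IH]; first by rewrite linear0.
by rewrite linearP IH (h _ Wx) addr0 mulr0.
Qed.

End LinearSpan.

Section Words.
Variables (R : realType) (A : cstarAlgType R) (tau : {scalar A}).
Hypothesis tau1 : tau 1 = 1.
Implicit Types (x y : A).

Section Family.
Variables (I : eqType) (B : I -> set A).

Definition alternating (w : seq (I * A)) : Prop :=
  sorted (fun p q => p.1 != q.1) w /\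
  forall p, p \in w -> B p.1 p.2 /\ tau p.2 = 0.

Definition word_value (w : seq (I * A)) : A := \prod_(p <- w) p.2.

Definition words (P : pred (seq (I * A))) : A -> Prop :=
  fun x => exists w, [/\ alternating w, P w & x = word_value w].

Lemma alternating_cons i x w :
  B i x -> tau x = 0 -> (if w is p :: _ then i != p.1 else true) ->
  alternating w -> alternating ((i, x) :: w).
Proof.
move=> Bx tx iw [sw hw]; split.
  by case: w iw sw {hw} => //= p w -> ->.
by move=> p; rewrite inE => /predU1P[->|/hw].
Qed.

Lemma alternating_behead p w : alternating (p :: w) -> alternating w.
Proof.
move=> [sw hw]; split; first exact: path_sorted sw.
by move=> q qw; apply: hw; rewrite inE qw orbT.
Qed.

Lemma alternating_cat u p v : alternating u -> alternating (p :: v) ->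
  all (fun q => q.1 != p.1) u -> alternating (u ++ p :: v).
Proof.
elim: u => [//|q u IHu] aqu apv /= /andP[qp up].
have [squ hqu] := aqu; have [Bq tq] := hqu q (mem_head _ _).
case: q qp aqu squ hqu Bq tq => i x /= ip aqu squ hqu Bx tx.
apply: alternating_cons => //; last exact: IHu (alternating_behead aqu) apv up.
by case: u squ {up aqu hqu IHu} => //= r u /andP[].
Qed.

Hypothesis freeB : free_subalgebras tau B.

Lemma tau_alternating w : alternating w -> w != [::] -> tau (word_value w) = 0.
Proof.
move=> [sw hw]; case: w sw hw => // p0 w; set W := p0 :: w => sw hw _.
rewrite /word_value (big_nth p0) big_mkord.
apply: (freeB (i := fun j => (nth p0 W j).1) (x := fun j => (nth p0 W j).2)) => //.
  by move=> j jl; apply: hw; rewrite mem_nth.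
by move=> j jl; apply/eqP; move/(sortedP p0): sw => /(_ j jl).
Qed.

Lemma tau_words (P : pred (seq (I * A))) x :
  (forall w, P w -> w != [::]) -> lspan (words P) x -> tau x = 0.
Proof.
by move=> nP; apply: lspan_ker => y [w [aw Pw ->]]; apply: tau_alternating => //; exact: nP.
Qed.

End Family.

Section Grouping.
Variables (I I' : eqType) (B : I -> set A) (pi : I -> I') (C : I' -> set A).
Hypothesis freeB : free_subalgebras tau B.
Hypothesis CB : forall i x, C i x -> tau x = 0 ->
  lspan (words B (fun w => (w != [::]) && all (fun p => pi p.1 == i) w)) x.

(** A centred element of the group k is a combination of nonempty alternating words
    with letters in that group.  A product of such elements whose groups alternate
    expands into concatenated words, which alternate again because consecutive
    words use letters of different groups. *)
Lemma free_grouping : free_subalgebras tau C.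
Proof.
move=> m i x m0 hx ine.
pose H k : pred (seq (I * A)) := fun w => if w is p :: _ then pi p.1 == k else false.
suff : lspan (words B (H (i 0))) (\prod_(j < m) x j).
  by apply: (tau_words freeB) => -[].
elim: m i x m0 hx ine => // m IHm i x _ hx ine; rewrite big_ord_recl /=.
have [Cx tx] := hx 0 isT; have x0 := CB Cx tx.
case: m IHm hx ine => [|m] IHm hx ine.
  rewrite big_ord0 mulr1; apply: lspan_sub x0 => y [w [aw /andP[w0 aw'] ->]].
  apply: lspan_base; exists w; split=> //.
  by case: w w0 aw' {aw} => //= p w _ /andP[].
have := IHm (fun j => i j.+1) (fun j => x j.+1) isT (fun j jm => hx j.+1 jm)
  (fun j jm => ine j.+1 jm).
apply: lspanM x0 => u v [w [aw /andP[w0 aw'] ->]] [w2 []].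
case: w2 => [|p w'] // apw' pw' ->.
apply: lspan_base; exists (w ++ p :: w'); split; last by rewrite /word_value big_cat.
  apply: alternating_cat => //; apply: sub_all aw' => q /eqP qi.
  apply/eqP => qp; have := ine 0 isT; apply; rewrite -qi qp; exact/eqP.
by case: w w0 aw' {aw} => //= q w _ /andP[].
Qed.

End Grouping.

Section Generated.
Variables (I : eqType) (B : I -> set A) (J : pred I).
Hypothesis BM : forall i x y, B i x -> B i y -> B i (x * y).
Hypothesis BB : forall i x c, B i x -> B i (x - c%:A).

Let full := lspan (words B (all (fun p => J p.1))).

Lemma full1 : full 1.
Proof. by apply: lspan_base; exists [::]; split=> //; rewrite /word_value big_nil. Qed.

(** Left multiplication by a letter keeps the span of alternating words: the letter
    is merged with the first letter if both have the same index, and the result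
    is split into its centred part and a scalar. *)
Lemma full_mull i x y : J i -> B i x -> full y -> full (x * y).
Proof.
move=> Ji Bx fy.
have cent z : B i z -> B i (z - (tau z)%:A) /\ tau (z - (tau z)%:A) = 0.
  by move=> Bz; split; [exact: BB|rewrite linearB linearZ /= tau1 mulr1 subrr].
have fsplit z v : full ((z - (tau z)%:A) * v) -> full v -> full (z * v).
  move=> h1 h2; rewrite -[z in z * v](subrK (tau z)%:A) mulrDl; apply: lspanD => //.
  by rewrite -scalerAl mul1r; exact: lspanZ.
have {}fy : lspan (words B (all (fun p => J p.1))) y := fy.
apply: (lspanM (W1 := fun z => z = x)) fy; last exact: lspan_base.
move=> _ _ -> [w [aw Jw ->]].
have fw v : alternating B v -> all (fun p => J p.1) v -> full (word_value v).
  by move=> av Jv; apply: lspan_base; exists v.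
have head z v : B i z -> alternating B v -> all (fun p => J p.1) v ->
    (if v is p :: _ then i != p.1 else true) -> full (z * word_value v).
  move=> Bz av Jv iv; have [Bc tc] := cent z Bz; apply: fsplit; last exact: fw.
  have -> : (z - (tau z)%:A) * word_value v = word_value ((i, z - (tau z)%:A) :: v).
    by rewrite /word_value big_cons.
  by apply: fw; [exact: alternating_cons|rewrite /= Ji].
case: w aw Jw => [|[k z] w] aw Jw; first exact: head.
have [ik|ik] := eqVneq i k; last exact: head.
have [_ /(_ _ (mem_head _ _))/= [Bz _]] := aw; subst k.
rewrite /word_value big_cons /= mulrA; apply: head => //; first exact: BM.
- exact: alternating_behead aw.
- by case/andP: Jw.
- by case: w aw Jw => //= p w [/andP[]].
Qed.

Lemma full_prod (s : seq I) (f : I -> A) y :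
  (forall i, i \in s -> J i /\ B i (f i)) -> full y ->
  full (\prod_(i <- s) f i * y).
Proof.
elim: s => [|i s IHs] h fy; first by rewrite big_nil mul1r.
rewrite big_cons -mulrA; have [Ji Bi] := h i (mem_head _ _).
apply: full_mull Ji Bi _; apply: IHs => // k ks; apply: h.
by rewrite inE ks orbT.
Qed.

Lemma full_horner x : (forall y, full y -> full (x * y)) ->
  forall p, full (horner_alg x p).
Proof.
move=> xf; elim/poly_ind => [|p c IHp]; first by rewrite linear0; exact: lspan0.
rewrite linearD /= rmorphM /= horner_algX horner_algC; apply: lspanD.
  suff -> : horner_alg x p * x = x * horner_alg x p by exact: xf.
  by rewrite -{2}[x]horner_algX -{3}[x]horner_algX -!rmorphM mulrC.
by apply: lspanZ; exact: full1.
Qed.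

(** Nonempty words have trace zero, so the coefficient of the empty word in an element
    of the span is its trace. *)
Lemma full_centered x : free_subalgebras tau B -> full x -> tau x = 0 ->
  lspan (words B (fun w => (w != [::]) && all (fun p => J p.1) w)) x.
Proof.
move=> freeB fx.
have [c [y [-> hy]]] : exists c y, x = c%:A + y /\
    lspan (words B (fun w => (w != [::]) && all (fun p => J p.1) w)) y.
  elim: fx => [|c {}x y [w [aw Jw ->]] _ [d [z [-> hz]]]].
    by exists 0, 0; rewrite scale0r addr0; split=> //; exact: lspan0.
  case: w aw Jw => [|p w] aw Jw.
    by exists (c + d), z; rewrite /word_value big_nil scalerDl addrA.
  exists d, (c *: word_value (p :: w) + z); rewrite addrCA; split=> //.
  by apply: lspanS => //; exists (p :: w).
have ty : tau y = 0 by apply: (tau_words freeB) hy => w /andP[].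
rewrite linearD linearZ /= tau1 mulr1 ty addr0 => ->.
by rewrite scale0r add0r.
Qed.

End Generated.
End Words.

(** * Multiplicativity of the S-transform *)

(** The cancellation behind multiplicativity: with P = 1 + c + c p and Q = 1 + c + c q
    the terms linear in p and q disappear from P Q - ((1 + c) / c) (P - 1) (Q - 1). *)
Lemma central_id (T : nzRingType) (c p q : T) : (forall z, z * c = c * z) ->
  c * (1 + c - c * (p * q)) =
  c * ((1 + c + c * p) * (1 + c + c * q)) -
  (1 + c) * ((1 + c + c * p - 1) * (1 + c + c * q - 1)).
Proof.
move=> cC.
have aux z : 1 + c + c * z = 1 + c * (1 + z) by rewrite mulrDr mulr1 addrA.
have -> : 1 + c - c * (p * q) = 1 + (c * (1 + p) + c * (1 + q) - c * ((1 + p) * (1 + q))).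
  rewrite -addrA -{1}[c]mulr1 -!mulrDr -!mulrBr; congr (1 + c * _).
  rewrite mulrDr mulr1 opprD addrACA subrr add0r mulrDl mul1r opprD addrA.
  by rewrite addrK.
rewrite !aux ![1 + _ - 1]addrAC !subrr !add0r.
move: (1 + p) (1 + q) => p1 q1.
have M : c * (c * (p1 * q1)) = c * p1 * (c * q1).
  by rewrite [RHS]mulrA -[c * p1 * c]mulrA cC !mulrA.
rewrite [1 + (_ - _)]addrA mulrBr M.
move: (c * p1) (c * q1) => x y.
rewrite [(1 + c) * _]mulrDl mul1r [(1 + x) * _]mulrDl mul1r [x * (1 + y)]mulrDr mulr1.
rewrite [1 + y + _]addrA [c * (1 + y + x + _)]mulrDr opprD.
by rewrite addrACA subrr addr0 [1 + y + x]addrAC addrA.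
Qed.

Lemma conj_split (T : nzRingType) (c a b P Q : T) : (forall z, z * c = c * z) ->
  a * (c * (P * Q) - (1 + c) * ((P - 1) * (Q - 1))) * b =
  c * (a * P * (Q * b)) - (1 + c) * (a * (P - 1) * ((Q - 1) * b)).
Proof.
move=> cC; rewrite mulrBr mulrBl; congr (_ - _).
  by rewrite !mulrA cC.
have cC1 z : z * (1 + c) = (1 + c) * z by rewrite mulrDr mulrDl mul1r mulr1 cC.
by rewrite !mulrA cC1.
Qed.

Lemma expand_sandwich (T : nzRingType) (c d p q v : T) : (forall z, z * c = c * z) ->
  (forall z, z * d = d * z) ->
  (d + c * q) * v * (d + c * p) = d ^+ 2 * v + d * c * (v * p) +
     (d * c * (q * v) + c ^+ 2 * (q * (v * p))).
Proof.
move=> cC dC; rewrite mulrDl mulrDr !mulrDl -!addrA; congr (_ + _).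
  by rewrite dC mulrA expr2.
rewrite addrCA; congr (_ + _).
  by rewrite -!mulrA [v * (c * p)]mulrA cC !mulrA.
congr (_ + _); first by rewrite dC !mulrA.
by rewrite !mulrA [c * q * v * c]cC expr2 !mulrA.
Qed.

Section Multiplicativity.
Variables (R : realType) (A : cstarAlgType R) (tau : {scalar A}).
Hypothesis tau1 : tau 1 = 1.
Local Notation F := R[i].
Implicit Types (p q : {poly A}) (r s : {poly F}) (a b x : A).

Lemma gen_subalgebraM a x y :
  gen_subalgebra a x -> gen_subalgebra a y -> gen_subalgebra a (x * y).
Proof. by move=> [p _ <-] [q _ <-]; exists (p * q); rewrite ?rmorphM. Qed.

Lemma gen_subalgebraB a x c : gen_subalgebra a x -> gen_subalgebra a (x - c%:A).
Proof.
by move=> [p _ <-]; exists (p - c%:P) => //; rewrite rmorphB /= horner_algC.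
Qed.

Definition cst (r : {poly F}) : {poly A} := map_poly (in_alg A) r.
Definition ptau (p : {poly A}) : {poly F} := map_poly tau p.

Lemma coef_cstM r p j : (cst r * p)`_j = \sum_(i < j.+1) r`_i *: p`_(j - i).
Proof.
by rewrite coefM; apply: eq_bigr => i _; rewrite coef_map /= -scalerAl mul1r.
Qed.

Lemma cst_comm r p : cst r * p = p * cst r.
Proof.
apply/polyP => j; rewrite coef_cstM coefMr; apply: eq_bigr => i _.
by rewrite coef_map /= -scalerAr mulr1.
Qed.

Lemma coef_ptau p j : (ptau p)`_j = tau p`_j.
Proof. by rewrite coef_map. Qed.

Lemma ptau_cstM r p : ptau (cst r * p) = r * ptau p.
Proof.
apply/polyP => j; rewrite coef_ptau coef_cstM linear_sum coefM.
by apply: eq_bigr => i _; rewrite linearZ /= coef_ptau.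
Qed.

Lemma ptauD p q : ptau (p + q) = ptau p + ptau q.
Proof. by apply/polyP => j; rewrite !(coef_ptau, coefD) linearD. Qed.

Lemma ptau_sum (I : Type) (l : seq I) (f : I -> {poly A}) :
  ptau (\sum_(i <- l) f i) = \sum_(i <- l) ptau (f i).
Proof.
apply: (big_morph ptau ptauD); apply/polyP => j.
by rewrite coef_ptau !coef0 linear0.
Qed.

Lemma ptau1 : ptau 1 = 1.
Proof.
by apply/polyP => j; rewrite coef_ptau !coefC; case: (j == 0%N); rewrite ?tau1 ?linear0.
Qed.

Lemma eqX_ptau n p q : p =X_n q -> ptau p =X_n ptau q.
Proof. by move=> h i il; rewrite !coef_ptau h. Qed.

Lemma eqX_cst n r s : r =X_n s -> cst r =X_n cst s.
Proof. by move=> h i il; rewrite !coef_map h. Qed.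

Lemma cst_scale_exp r a i : (cst r * a%:P) ^+ i = cst (r ^+ i) * (a ^+ i)%:P.
Proof.
rewrite exprMn_comm; last by rewrite /GRing.comm cst_comm.
by rewrite /cst !rmorphXn.
Qed.

Lemma geometric_inverse n p : p`_0 = 0 ->
  (1 - p) * (\sum_(i < n) p ^+ i) =X_n 1 /\ (\sum_(i < n) p ^+ i) * (1 - p) =X_n 1.
Proof.
move=> p0.
have e : (1 - p) * (\sum_(i < n) p ^+ i) =X_n 1.
  rewrite -opprB mulNr -subrX1 opprB.
  have [q ->] := poly_XM p0; rewrite exprMn_comm; last exact/commr_sym/commr_polyX.
  by rewrite (eqXXn _ (leqnn n)) subr0.
split=> //; rewrite (_ : _ * _ = (1 - p) * (\sum_(i < n) p ^+ i))//.
rewrite mulr_suml mulr_sumr; apply: eq_bigr => i _.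
by rewrite mulrBr mulrBl mulr1 mul1r -exprS -exprSr.
Qed.

Lemma ptau_geometric n r a :
  ptau (\sum_(i < n) (cst r * a%:P) ^+ i) =
  \sum_(i < n) tau (a ^+ i) *: r ^+ i.
Proof.
rewrite ptau_sum; apply: eq_bigr => i _; rewrite cst_scale_exp ptau_cstM.
rewrite mulrC -mul_polyC; congr (_ * _); apply/polyP => j.
by rewrite coef_ptau !coefC; case: (j == 0%N); rewrite ?linear0.
Qed.

Lemma series_comp N (m : nat -> F) r :
  series N m \Po r = \sum_(i < N.+1) m i *: r ^+ i.
Proof.
rewrite /series poly_def linear_sum; apply: eq_bigr => i _ /=.
by rewrite comp_polyZ comp_Xn_poly.
Qed.

Definition centered a x := gen_subalgebra a x /\ tau x = 0.

Definition coefs (V : A -> Prop) p := forall i, V p`_i.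

(** The defining equation of the S-transform says that the resolvent has trace
    1 + z.  Subtracting 1 + z makes its coefficients centred, and the constant
    coefficient 1 cancels, which leaves a factor z. *)
Lemma centered_resolvent N a (sg : {poly F}) :
  series N (fun m => tau (a ^+ m)) \Po ('X * sg) =X_N.+1 1 + 'X ->
  exists2 q, coefs (centered a) q &
    let w := cst ('X * sg) * a%:P in
    (1 - w) * (1 + 'X + 'X * q) =X_N.+1 1 /\
    (1 + 'X + 'X * q) * (1 - w) =X_N.+1 1.
Proof.
move=> sgE; set w := cst _ * _; pose G := \sum_(i < N.+1) w ^+ i.
have w0 : w`_0 = 0.
  by rewrite coef_cstM big_ord1 coefXM scale0r.
have [G1 G2] := geometric_inverse N.+1 w0; rewrite -/G in G1 G2.
pose q := take_poly N (drop_poly 1 (G - (1 + 'X))).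
have GE : G =X_N.+1 1 + 'X + 'X * q.
  have G0 : G`_0 = 1.
    have := G1 0 isT; rewrite coefM big_ord1 coefB w0 coefC/= subr0 mul1r.
    by rewrite subn0.
  move=> [|i] il; first by rewrite G0 !coefD coefXM coefX coefC/= !addr0.
  rewrite coefD coefXM /q coef_take_poly coef_drop_poly -[(i < N)%N]/(i.+1 < N.+1)%N il.
  by rewrite /= addn1 coefB addrC subrK.
exists q; last by rewrite /=; split; rewrite -?GE.
have genG i : gen_subalgebra a G`_i.
  exists (\sum_(j < N.+1) (('X * sg) ^+ j)`_i *: 'X^j) => //.
  rewrite linear_sum coef_sum; apply: eq_bigr => j _.
  rewrite /= linearZ /= rmorphXn /= horner_algX cst_scale_exp.
  by rewrite coefMC coef_map /= -scalerAl mul1r.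
move=> i; rewrite coef_take_poly coef_drop_poly; case: ltnP => [iN|_]; last first.
  by split; [exists 0; rewrite ?rmorph0|rewrite linear0].
have cE : (1 + 'X : {poly A})`_(i + 1) = ((1 + 'X : {poly F})`_(i + 1))%:A.
  by rewrite addn1 !coefD !coef1 !coefX !add0r; case: (i.+1 == 1%N); rewrite ?scale1r ?scale0r.
split; first by rewrite coefB cE; exact: gen_subalgebraB.
rewrite coefB cE linearB linearZ /= tau1 mulr1 -coef_ptau ptau_geometric.
have := sgE (i + 1)%N; rewrite series_comp => ->; first by rewrite subrr.
by rewrite addn1 ltnS.
Qed.

Section FreePair.
Variables (a b : A).
Let ab := fun t : bool => if t then a else b.
Hypothesis free_ab : free_elements tau ab.

Let E t := lspan (words tau (fun t => gen_subalgebra (ab t))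
  (fun w => if w is p :: _ then p.1 == t else false)).

Let tauE t x : E t x -> tau x = 0.
Proof. by apply: tau_words => // -[]. Qed.

Let E_base t x : centered (ab t) x -> E t x.
Proof.
move=> [gx tx]; apply: lspan_base; exists [:: (t, x)]; split=> //=.
- by apply: alternating_cons => //; split=> // p; rewrite in_nil.
- by rewrite /word_value big_seq1.
Qed.

Let E_mul t x y : centered (ab t) x -> E (~~ t) y -> E t (x * y).
Proof.
move=> [gx tx]; apply: (lspanM (W1 := fun z => z = x)); last exact: lspan_base.
move=> _ v -> [[|p w] [aw // pw ->]]; apply: lspan_base.
exists ((t, x) :: p :: w); split=> //=; last by rewrite /word_value !big_cons.
by apply: alternating_cons => //=; rewrite (eqP pw); case: (t).
Qed.

Let coefsM t p q : coefs (centered (ab t)) p -> coefs (E (~~ t)) q -> coefs (E t) (p * q).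
Proof.
by move=> hp hq i; rewrite coefM; apply: lspan_sum => j; exact: E_mul.
Qed.

Let ptauE t p : coefs (E t) p -> ptau p = 0.
Proof. by move=> h; apply/polyP => i; rewrite coef_ptau coef0; exact: tauE. Qed.

(** The coefficients of p and q are centred elements of the two algebras, so each
    product below expands into nonempty alternating words, except the empty
    product. *)
Lemma ptau_alternating p q i :
  coefs (centered a) p -> coefs (centered b) q ->
  [/\ ptau ((p * q) ^+ i) = (i == 0)%:R, ptau ((p * q) ^+ i * p) = 0,
      ptau (q * (p * q) ^+ i) = 0 & ptau (q * ((p * q) ^+ i * p)) = 0].
Proof.
move=> cp cq.
have cEp : coefs (E true) p by move=> j; exact: (E_base (t := true)).
have cEq : coefs (E false) q by move=> j; exact: (E_base (t := false)).
have c1 k : coefs (E true) ((p * q) ^+ k * p).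
  elim: k => [|k IHk]; first by rewrite expr0 mul1r.
  rewrite exprS -!mulrA; apply: (coefsM (t := true)) => //.
  exact: (coefsM (t := false)).
have c2 k : coefs (E false) (q * (p * q) ^+ k).
  elim: k => [|k IHk]; first by rewrite expr0 mulr1.
  rewrite exprS -!mulrA; apply: (coefsM (t := false)) => //.
  exact: (coefsM (t := true)).
split; [|exact: ptauE (c1 i)|exact: ptauE (c2 i)|].
- case: i => [|i]; first by rewrite expr0 ptau1.
  by rewrite exprS -mulrA; apply: (ptauE (t := true)); apply: (coefsM (t := true)).
- by apply: (ptauE (t := false)); apply: (coefsM (t := false)).
Qed.

(** With P = (1 - s a)^-1 and Q = (1 - t b)^-1, the inverse of 1 - r a b is
    Q (1 + z - z p q)^-1 P up to the truncation order, and its trace is computed by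
    expanding the middle factor. *)
Lemma S_transform_mul N Sa Sb :
  S_transform N (fun m => tau (a ^+ m)) Sa ->
  S_transform N (fun m => tau (b ^+ m)) Sb ->
  S_transform N (fun m => tau ((a * b) ^+ m)) (Sa * Sb).
Proof.
move=> [sa <- saE] [sb <- sbE].
have [p cp [pl pr]] := centered_resolvent saE.
have [q cq [ql qr]] := centered_resolvent sbE.
set wa := cst _ * _ in pl pr; set wb := cst _ * _ in ql qr.
exists ((1 + 'X) * (sa * sb)); first by rewrite mulrACA mulrA.
pose r : {poly F} := 'X * ((1 + 'X) * (sa * sb)).
pose w := cst r * (a * b)%:P.
set Pa := 1 + 'X + 'X * p in pl pr; set Pb := 1 + 'X + 'X * q in ql qr.
pose Y := 1 + 'X - 'X * (p * q).
have wa0 : wa`_0 = 0 by rewrite coef_cstM big_ord1 coefXM scale0r.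
have wb0 : wb`_0 = 0 by rewrite coef_cstM big_ord1 coefXM scale0r.
have w0 : w`_0 = 0 by rewrite coef_cstM big_ord1 coefXM scale0r.
have XC (v : {poly A}) : v * 'X = 'X * v by rewrite commr_polyX.
have cX : cst 'X = 'X by rewrite /cst map_polyX.
have c1X : cst (1 + 'X) = 1 + 'X by rewrite /cst rmorphD rmorph1 /= map_polyX.
have cM (x y : {poly F}) : cst (x * y) = cst x * cst y by rewrite /cst rmorphM.
have YE : 'X * Y = 'X * (Pa * Pb) - (1 + 'X) * ((Pa - 1) * (Pb - 1)).
  exact: central_id.
have wab : 'X * w = (1 + 'X) * (wa * wb).
  have -> : wa * wb = cst ('X * sa * ('X * sb)) * (a * b)%:P.
    rewrite /wa /wb -mulrA (mulrA a%:P) -(cst_comm _ a%:P).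
    by rewrite -(mulrA (cst _) a%:P) (mulrA (cst _)) -cM -polyCM.
  rewrite -c1X -cX /w !mulrA -!cM; congr (cst _ * _); rewrite /r; ring.
(* The identity is multiplied by z, to avoid the division by z of [central_id]; no order is
   lost because all error terms carry an extra factor z. *)
have main : (1 - wa) * Y * (1 - wb) =X_N.+1 1 - w.
  apply: eqX_XMI.
  pose al := (1 - wa) * (Pa - 1); pose be := (Pb - 1) * (1 - wb).
  have alE : al =X_N.+1 wa by rewrite /al mulrBr mulr1 pl opprB addrC subrK.
  have beE : be =X_N.+1 wb by rewrite /be mulrBl mul1r qr opprB addrC subrK.
  have albe : al * be =X_N.+2 wa * wb.
    rewrite (eqX_mulX _ beE); last by rewrite alE.
    exact: eqX_mulXr.
  have -> : 'X * ((1 - wa) * Y * (1 - wb)) =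
      'X * ((1 - wa) * Pa * (Pb * (1 - wb))) - (1 + 'X) * (al * be).
    by rewrite -conj_split// -YE !mulrA XC.
  rewrite albe -wab [X in _ =X_ _ X]mulrBr mulr1; apply: eqXD => //.
  rewrite -[X in _ =X_ _ X]mulr1; apply: eqX_XM.
  by rewrite pl qr mulr1.
have [j jE] : exists j : {poly F}, (1 + 'X) * j =X_N.+1 1.
  by apply: mul_inverse; rewrite coefD coefC coefX addr0 oner_eq0.
pose h := 'X * j; pose u := cst h * (p * q).
have u0 : u`_0 = 0 by rewrite coef_cstM big_ord1 coefXM scale0r.
pose Z := cst j * \sum_(i < N.+1) u ^+ i.
have YZ : Y * Z =X_N.+1 1.
  have Yj : Y * cst j =X_N.+1 1 - u.
    have uE : 'X * (p * q) * cst j = u.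
      by rewrite -cst_comm mulrA XC -cX -cM.
    rewrite /Y mulrBl uE.
    by apply: eqXD => //; rewrite -c1X -cM (eqX_cst jE) /cst rmorph1.
  by rewrite mulrA Yj (geometric_inverse N.+1 u0).1.
have GE : \sum_(i < N.+1) w ^+ i =X_N.+1 Pb * Z * Pa.
  have wP : (1 - w) * (Pb * Z * Pa) =X_N.+1 1.
    rewrite -main; move: YZ; move: Z => z YZ; rewrite -!mulrA (mulrA (1 - wb)) ql mul1r (mulrA Y) YZ mul1r.
    exact: pl.
  rewrite -[X in X =X_ _ _]mulr1 -{1}wP mulrA (geometric_inverse N.+1 w0).2.
  by rewrite mul1r.
rewrite series_comp -(ptau_geometric N.+1 r (a * b)) -/w (eqX_ptau GE).
have ZE : Pb * Z * Pa = \sum_(i < N.+1) cst (j * h ^+ i) * (Pb * (p * q) ^+ i * Pa).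
  rewrite /Z !mulr_sumr mulr_suml; apply: eq_bigr => i _.
  rewrite /u exprMn_comm; last by rewrite /GRing.comm cst_comm.
  have -> : cst h ^+ i = cst (h ^+ i) by rewrite /cst rmorphXn.
  by rewrite [cst j * _]mulrA -cM !mulrA -cst_comm.
have PvP i : ptau (Pb * (p * q) ^+ i * Pa) = (1 + 'X) ^+ 2 * (i == 0)%:R.
  have [e1 e2 e3 e4] := ptau_alternating i cp cq.
  set v := (p * q) ^+ i in e1 e2 e3 e4 *.
  have PaE : Pa = cst (1 + 'X) + cst 'X * p by rewrite c1X cX.
  have PbE : Pb = cst (1 + 'X) + cst 'X * q by rewrite c1X cX.
  rewrite PaE PbE expand_sandwich; [|by move=> z; rewrite cst_comm..].
  rewrite -!cM.
  have cX2 k r' : cst r' ^+ k = cst (r' ^+ k) by rewrite /cst rmorphXn.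
  rewrite !cX2.
  by rewrite !ptauD !ptau_cstM e1 e2 e3 e4 !mulr0 !addr0.
rewrite ZE ptau_sum big_ord_recl big1 ?addr0 => [|i _]; last first.
  by rewrite ptau_cstM PvP !mulr0.
rewrite ptau_cstM PvP expr0 !mulr1 mulrC expr2 -mulrA.
rewrite [X in _ * X]jE mulr1.
by [].
Qed.

End FreePair.
End Multiplicativity.

(** * The trace as a positive functional *)
Lemma discriminant_le (K : realFieldType) (p r q : K) :
  (forall t, 0 <= p + 2 * t * r + t ^+ 2 * q) -> 0 <= q ->
  r ^+ 2 <= p * q.
Proof.
move=> h qge0; have [q0|q0] := eqVneq q 0.
  subst q; have [->|r0] := eqVneq r 0; first by rewrite expr0n /= mulr0.
  have := h (- (p + 1) / (2 * r)).
  rewrite mulr0 addr0 (_ : 2 * _ * r = - (p + 1)); last by field.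
  by lra.
have qpos : 0 < q by rewrite lt_def q0.
have := h (- r / q); rewrite (_ : p + _ + _ = p - r ^+ 2 / q); last by field.
by rewrite subr_ge0 ler_pdivrMr.
Qed.

Lemma exp_unbounded (K : archiRealFieldType) (r B : K) : 1 < r -> exists k, B < r ^+ k.
Proof.
move=> r1.
have bern k : 1 + k%:R * (r - 1) <= r ^+ k.
  elim: k => [|k IHk]; first by rewrite mul0r addr0 expr0.
  rewrite exprS; apply: le_trans (ler_wpM2l _ IHk); last by lra.
  rewrite -natr1; have : 0 <= k%:R * (r - 1) by rewrite mulr_ge0 ?ler0n//; lra.
  nra.
have rp : 0 < r - 1 by lra.
exists (Num.bound (`|B| / (r - 1))).
apply: lt_le_trans (bern _).
have : `|B| / (r - 1) < (Num.bound (`|B| / (r - 1)))%:R.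
  by apply: archi_boundP; rewrite divr_ge0// ltW.
by rewrite ltr_pdivrMr//; have := ler_norm B; lra.
Qed.

Section StarState.
Variables (R : realType) (A : cstarAlgType R) (tau : {scalar A}).
Hypothesis state : tracial_state tau.
Implicit Types (x y z u : A) (t : R).

Let tau1 : tau 1 = 1. Proof. by case: state. Qed.
Let tau_ge0 x : 0 <= tau (star x * x). Proof. by case: state. Qed.
Lemma tauC x y : tau (x * y) = tau (y * x). Proof. by case: state. Qed.

Lemma star1 : star (1 : A) = 1.
Proof.
have e x : star 1 * x = x by rewrite -{1}(starK x) -starM mulr1 starK.
by rewrite -[LHS]mulr1 e.
Qed.

Lemma star0 : star (0 : A) = 0.
Proof. by apply: (addrI (star 0)); rewrite -starD !addr0. Qed.

Lemma starN x : star (- x) = - star x.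
Proof. by apply/eqP; rewrite -addr_eq0 -starD addNr star0. Qed.

Lemma starX x n : star (x ^+ n) = star x ^+ n.
Proof. by elim: n => [|n IHn]; rewrite ?expr0 ?star1// exprS starM IHn exprSr. Qed.

Lemma star_real t x : star (t%:C *: x) = t%:C *: star x.
Proof. by rewrite starZ conjc_real. Qed.

(** Inequalities are stated for the real part, which is additive and real-linear;
    [tau_eq0] recovers the complex trace. *)
Definition rtau x : R := complex.Re (tau x).

Lemma rtauD x y : rtau (x + y) = rtau x + rtau y.
Proof. by rewrite /rtau linearD; case: (tau x) (tau y) => [a b] [c d]. Qed.

Lemma rtau0 : rtau 0 = 0.
Proof. by rewrite /rtau linear0. Qed.

Lemma rtau_ker x : tau x = 0 -> rtau x = 0.
Proof. by rewrite /rtau => ->. Qed.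

Lemma rtauZ t x : rtau (t%:C *: x) = t * rtau x.
Proof. by rewrite /rtau linearZ; case: (tau x) => [a b] /=; rewrite mul0r subr0. Qed.

Lemma rtauN x : rtau (- x) = - rtau x.
Proof. by rewrite /rtau linearN; case: (tau x). Qed.

Lemma rtauC x y : rtau (x * y) = rtau (y * x).
Proof. by rewrite /rtau tauC. Qed.

Lemma rtau_ge0 x : 0 <= rtau (star x * x).
Proof. by have := tau_ge0 x; rewrite /rtau lecE /= => /andP[_]. Qed.

(** The trace of (x + i y)* (x + i y) has imaginary part zero by positivity, and this
    part is the difference of the two sides. *)
Lemma rtau_sym x y : rtau (star x * y) = rtau (star y * x).
Proof.
have im z : complex.Im (tau (star z * z)) = 0 by exact/ger0_Im.
have := im (x + 'i *: y); rewrite starD starZ mulrDl !mulrDr.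
rewrite -!scalerAl -!scalerAr !linearD !linearZ /= -/(rtau _).
move: (im x) (im y); rewrite /rtau.
case: (tau (star x * x)) => a1 b1; case: (tau (star y * y)) => a2 b2.
case: (tau (star x * y)) => a3 b3; case: (tau (star y * x)) => a4 b4 /=.
move=> -> ->; rewrite !(mul0r, mul1r, mulN1r, mulr0, add0r, addr0, subr0, oppr0).
by move=> /eqP; rewrite subr_eq0 => /eqP.
Qed.

Lemma tau_eq0 z : rtau z = 0 -> rtau ('i *: z) = 0 -> tau z = 0.
Proof.
rewrite /rtau linearZ; case: (tau z) => a b /= -> h.
by congr Complex; move: h; rewrite mul0r mul1r sub0r => /eqP; rewrite oppr_eq0 => /eqP.
Qed.

Lemma rtau_CS x y :
  rtau (star x * y) ^+ 2 <= rtau (star x * x) * rtau (star y * y).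
Proof.
have e t : rtau (star (x + t%:C *: y) * (x + t%:C *: y)) = rtau (star x * x) +
    (t * rtau (star x * y) + (t * rtau (star x * y) + t * (t * rtau (star y * y)))).
  rewrite starD star_real mulrDl !mulrDr -!scalerAl -!scalerAr !rtauD !rtauZ.
  by rewrite (rtau_sym y x) -addrA.
apply: discriminant_le (rtau_ge0 y) => t; have := rtau_ge0 (x + t%:C *: y).
rewrite e; move: (rtau _) (rtau _) (rtau _) => p r q.
by congr (is_true (0 <= _)); ring.
Qed.

Section Contraction.
Variables (c u : A).
Hypothesis uE : u = star c * c.
Hypothesis u_mom : forall n, rtau (u ^+ (2 * n)) <= 1.

Lemma star_u : star u = u.
Proof. by rewrite uE starM starK. Qed.

(** Let phi n be the trace of y* u^n y.  By Cauchy-Schwarz phi(n)^2 <= phi(0) phi(2n), so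
    a ratio r = phi(1) / phi(0) > 1 would make phi(2^k) grow like r^(2^k).  By
    traciality and Cauchy-Schwarz again, phi is bounded by the even moments of u.
    This replaces the C*-norm by information on moments. *)
Lemma contraction y : rtau (star y * u * y) <= rtau (star y * y).
Proof.
pose phi n := rtau (star y * u ^+ n * y).
have phi0 : phi 0 = rtau (star y * y) by rewrite /phi expr0 mulr1.
have phi1 : phi 1%N = rtau (star y * u * y) by rewrite /phi expr1.
rewrite -phi0 -phi1 leNgt; apply/negP => lt01.
have phiCS n : phi n ^+ 2 <= phi 0 * phi (2 * n)%N.
  have := rtau_CS y (u ^+ n * y); rewrite starM starX star_u phi0 mulrA.
  by rewrite -!mulrA (mulrA (u ^+ n) (u ^+ n)) -exprD addnn -mul2n /phi !mulrA.
have p0 : 0 <= phi 0 by rewrite phi0 rtau_ge0.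
have pp : 0 < phi 0.
  rewrite lt_def p0 andbT; apply/eqP => p00.
  by have := phiCS 1%N; rewrite p00 mul0r; nra.
pose K := rtau (star (y * star y) * (y * star y)).
have bnd n : phi n ^+ 2 <= K.
  have -> : phi n = rtau (star (u ^+ n) * (y * star y)).
    by rewrite starX star_u /phi rtauC mulrA rtauC !mulrA rtauC !mulrA.
  apply: le_trans (rtau_CS _ _) _; rewrite -/K starX star_u -exprD addnn -mul2n.
  by rewrite ler_piMl ?u_mom// rtau_ge0.
pose r := phi 1%N / phi 0.
have r1 : 1 < r by rewrite ltr_pdivlMr// mul1r.
have grow k : phi 0 * r ^+ (2 ^ k) <= phi (2 ^ k)%N.
  elim: k => [|k IHk]; first by rewrite expn0 expr1 /r mulrC divfK ?gt_eqF.
  rewrite expnS; have h := phiCS (2 ^ k)%N.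
  have rk : 0 <= r ^+ (2 ^ k) by rewrite exprn_ge0//; lra.
  rewrite -(ler_pM2l pp); apply: le_trans h.
  rewrite mulrA -expr2 mulnC exprM -exprMn ler_sqr ?nnegrE ?mulr_ge0//.
  by apply: le_trans IHk; rewrite mulr_ge0.
(* phi (2 ^ k) > K + 1 contradicts phi (2 ^ k) ^ 2 <= K. *)
have [k hk] := exp_unbounded ((K + 1) / phi 0) r1.
have rk : r ^+ k <= r ^+ (2 ^ k) by rewrite ler_eXn2l// ltnW// ltn_expl.
have : K + 1 < phi (2 ^ k)%N.
  apply: lt_le_trans (grow k); rewrite mulrC -ltr_pdivrMr//.
  exact: lt_le_trans rk.
have := bnd (2 ^ k)%N; have : 0 <= K by rewrite rtau_ge0.
nra.
Qed.
End Contraction.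
End StarState.

(** * Approximating a positive element by polynomials in its square *)
Section Cone.
Variable R : realFieldType.
Implicit Types (p q : {poly R}).

(** The convex cone generated by the products x^i (1 - x)^j: polynomials whose
    positivity on [0, 1] is visible, so that it can be transferred to an element
    u with 0 <= u <= 1 without functional calculus. *)
Inductive cone : {poly R} -> Prop :=
| cone0 : cone 0
| coneS c i j q : 0 <= c -> cone q ->
    cone (c *: ('X ^+ i * (1 - 'X) ^+ j) + q).

Lemma cone_monomial i j : cone ('X ^+ i * (1 - 'X) ^+ j).
Proof. by rewrite -[_ * _]addr0 -[_ * _]scale1r; apply: coneS => //; exact: cone0. Qed.

Lemma coneX : cone 'X.
Proof. by have := cone_monomial 1 0; rewrite expr1 expr0 mulr1. Qed.

Lemma cone1BX : cone (1 - 'X).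
Proof. by have := cone_monomial 0 1; rewrite expr1 expr0 mul1r. Qed.

Lemma coneD p q : cone p -> cone q -> cone (p + q).
Proof.
move=> hp hq; elim: hp => [|c i j p' c0 _ IH]; first by rewrite add0r.
by rewrite -addrA; exact: coneS.
Qed.

Lemma coneZ c p : 0 <= c -> cone p -> cone (c *: p).
Proof.
move=> c0; elim=> [|d i j p' d0 _ IH]; first by rewrite scaler0; exact: cone0.
by rewrite scalerDr scalerA; apply: coneS => //; exact: mulr_ge0.
Qed.

Lemma coneM p q : cone p -> cone q -> cone (p * q).
Proof.
move=> hp hq; elim: hp => [|c i j p' c0 _ IH]; first by rewrite mul0r; exact: cone0.
rewrite mulrDl -scalerAl; apply: coneD => //; apply: coneZ => // {IH c0}.
elim: hq => [|d k l q' d0 _ IH]; first by rewrite mulr0; exact: cone0.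
rewrite mulrDr -scalerAr mulrACA -!exprD; apply: coneD => //.
by apply: coneZ => //; exact: cone_monomial.
Qed.

(** The classical iteration p := p + (y - p^2) / 2 for the square root of y. *)
Fixpoint sqrt_approx n : {poly R} :=
  if n is n'.+1 then sqrt_approx n' + (2^-1)%:P * ('X - sqrt_approx n' ^+ 2) else 0.

Definition sqrt_error n : {poly R} := 'X - (sqrt_approx n \Po 'X^2).

Let half : {poly R} := (2^-1)%:P.
Let halfD : half + half = 1.
Proof. by rewrite -polyCD -polyC1; congr _%:P; field. Qed.
Let half_ge0 p : cone p -> cone (half * p).
Proof. by move=> hp; rewrite mul_polyC; apply: coneZ. Qed.

Lemma sqrt_approxS n : sqrt_approx n.+1 \Po 'X^2 =
  (sqrt_approx n \Po 'X^2) + half * ('X ^+ 2 - (sqrt_approx n \Po 'X^2) ^+ 2).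
Proof.
by rewrite /= comp_polyD comp_polyM comp_polyC comp_polyB comp_polyX !expr2 comp_polyM.
Qed.

(** Put y = x^2 and e = x - p.  The next error is e ((1 - x) + e / 2), and the next
    approximation is p + e (x + p) / 2: both stay in the cone. *)
Lemma cone_sqrt n : cone (sqrt_error n) /\ cone (sqrt_approx n \Po 'X^2).
Proof.
elim: n => [|n [IHe IHp]].
  by rewrite /sqrt_error /= comp_poly0 subr0; split; [exact: coneX|exact: cone0].
rewrite /sqrt_error sqrt_approxS; move: IHe; rewrite /sqrt_error.
set p := _ \Po _ in IHp *; set x := 'X => IHe.
have -> : x - (p + half * (x ^+ 2 - p ^+ 2)) = (x - p) * ((1 - x) + half * (x - p)).
  suff -> : x - (p + half * (x ^+ 2 - p ^+ 2)) =
      (x - p) * (1 - x + half * (x - p)) + (1 - (half + half)) * (x ^+ 2 - p * x).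
    by rewrite halfD subrr mul0r addr0.
  by ring.
have -> : x ^+ 2 - p ^+ 2 = (x - p) * (x + p) by ring.
split.
  by apply: coneM => //; apply: coneD; [exact: cone1BX|exact: half_ge0].
by apply: coneD => //; apply: half_ge0; apply: coneM => //; apply: coneD => //; exact: coneX.
Qed.

Lemma sqrt_error_decr n : exists2 q, cone q &
  sqrt_error n - sqrt_error n.+1 = half * sqrt_error n ^+ 2 + q.
Proof.
have [ce cp] := cone_sqrt n.
exists (sqrt_error n * (sqrt_approx n \Po 'X^2)); first exact: coneM.
rewrite /sqrt_error sqrt_approxS; set p := _ \Po _; set x := 'X.
suff -> : x - p - (x - (p + half * (x ^+ 2 - p ^+ 2))) =
    half * (x - p) ^+ 2 + (x - p) * p + (half + half - 1) * (x * p - p ^+ 2).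
  by rewrite halfD subrr mul0r addr0.
by ring.
Qed.

(** The error e decreases by at least e^2 / 2 at each step, so the sum of the squares
    telescopes.  Its boundedness is enough to make some square arbitrarily small. *)
Lemma sqrt_error_small (S : {poly R} -> R) :
  (forall p q, S (p + q) = S p + S q) -> (forall c p, S (c *: p) = c * S p) ->
  (forall p, cone p -> 0 <= S p) ->
  forall N, \sum_(n < N) S (sqrt_error n ^+ 2) <= 2 * S 'X.
Proof.
move=> SD SZ S0 N.
have SB p q : S (p - q) = S p - S q by rewrite SD -scaleN1r SZ mulN1r.
have step n : S (sqrt_error n ^+ 2) <= 2 * (S (sqrt_error n) - S (sqrt_error n.+1)).
  have [q cq] := sqrt_error_decr n => /(congr1 S).
  rewrite SB (SD (half * _)) [half * _]mul_polyC SZ => ->; have := S0 q cq.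
  have : 2 * 2^-1 = 1 :> R by field.
  by move: (S _) (S _) 2^-1 => s t h; nra.
have tel : \sum_(n < N) S (sqrt_error n ^+ 2) <= 2 * (S 'X - S (sqrt_error N)).
  elim: N => [|N IHN].
    by rewrite big_ord0 /sqrt_error /= comp_poly0 subr0 subrr mulr0.
  by rewrite big_ord_recr /=; have := step N; lra.
by have := S0 _ (cone_sqrt N).1; lra.
Qed.

End Cone.
Arguments sqrt_approx {R}.
Arguments sqrt_error {R}.

Section Density.
Variables (R : realType) (A : cstarAlgType R) (tau : {scalar A}).
Hypothesis state : tracial_state tau.
Implicit Types (x y z h Y : A) (t : R).
Local Notation rtau := (rtau tau).

Definition ev (u : A) (p : {poly R}) : A := horner_alg u (map_poly (real_complex R) p).

Lemma evM u p q : ev u (p * q) = ev u p * ev u q.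
Proof. by rewrite /ev rmorphM /= rmorphM. Qed.
Lemma evD u p q : ev u (p + q) = ev u p + ev u q.
Proof. by rewrite /ev rmorphD /= rmorphD. Qed.
Lemma ev1 u : ev u 1 = 1. Proof. by rewrite /ev rmorph1 /= rmorph1. Qed.
Lemma evX u : ev u 'X = u. Proof. by rewrite /ev map_polyX horner_algX. Qed.
Lemma evXn u p n : ev u (p ^+ n) = ev u p ^+ n.
Proof. by rewrite /ev rmorphXn /= rmorphXn. Qed.
Lemma evZ u c p : ev u (c *: p) = c%:C *: ev u p.
Proof. by rewrite /ev map_polyZ linearZ /= mulr_algl. Qed.
Lemma evB u p q : ev u (p - q) = ev u p - ev u q.
Proof. by rewrite /ev rmorphB /= rmorphB. Qed.

Lemma horner_alg_comp (u : A) (p r : {poly R[i]}) :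
  horner_alg (horner_alg u r) p = horner_alg u (p \Po r).
Proof.
elim/poly_ind: p => [|p d IHp]; first by rewrite comp_poly0 !linear0.
rewrite comp_poly_MXaddC !rmorphD /= !rmorphM /= IHp horner_algX.
by rewrite !horner_algC.
Qed.

Lemma horner_algXn (u : A) n : horner_alg u ('X^n) = u ^+ n.
Proof. by rewrite rmorphXn /= horner_algX. Qed.

Lemma star_ev u p : star u = u -> star (ev u p) = ev u p.
Proof.
move=> su; elim/poly_ind: p => [|p c IHp]; first by rewrite /ev !rmorph0 star0.
have -> : p * 'X + c%:P = p * 'X + c *: 1 by rewrite alg_polyC.
rewrite evD evM evX evZ ev1 starD starM star_real star1 su IHp; congr (_ + _).
by have : ev u ('X * p) = ev u (p * 'X) by [rewrite mulrC]; rewrite !evM evX.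
Qed.

Section PositiveContraction.
Variables (c u : A).
Hypothesis uE : u = star c * c.
Hypothesis u_mom : forall n, rtau (u ^+ (2 * n)) <= 1.

Let su : star u = u := star_u uE.

(** Even powers of u and 1 - u can be moved to the two sides, which leaves the four
    cases 1, u, 1 - u and u (1 - u); the last one equals
    (1 - u) u (1 - u) + u (1 - u) u. *)
Lemma cone_rtau_ge0 h p : cone p -> 0 <= rtau (star h * ev u p * h).
Proof.
have u_ge0 y : 0 <= rtau (star y * u * y).
  by have := rtau_ge0 state (c * y); rewrite starM uE !mulrA.
have v_ge0 y : 0 <= rtau (star y * (1 - u) * y).
  rewrite mulrBr mulrBl mulr1 rtauD rtauN subr_ge0.
  exact: (contraction state uE u_mom y).
have uv_ge0 y : 0 <= rtau (star y * (u * (1 - u)) * y).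
  have -> : u * (1 - u) = (1 - u) * u * (1 - u) + u * (1 - u) * u.
    have -> : 1 - u = ev u (1 - 'X) by rewrite evB ev1 evX.
    have e : ev u ('X * (1 - 'X)) =
        ev u ((1 - 'X) * 'X * (1 - 'X) + 'X * (1 - 'X) * 'X) by congr (ev u _); ring.
    by move: e; rewrite evD !evM evX.
  rewrite mulrDr mulrDl rtauD; apply: addr_ge0.
    have := u_ge0 ((1 - u) * y); rewrite starM starD starN star1 su !mulrA.
    by [].
  by have := v_ge0 (u * y); rewrite starM su !mulrA.
elim=> [|d i j q d0 _ IH].
  by rewrite /ev !rmorph0 mulr0 mul0r rtau0.
rewrite evD mulrDr mulrDl rtauD; apply: addr_ge0 => // {IH}.
rewrite evZ -scalerAr -scalerAl rtauZ; apply: mulr_ge0 => //.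
pose w := ev u ('X ^+ i./2 * (1 - 'X) ^+ j./2).
pose g := ev u ('X ^+ odd i * (1 - 'X) ^+ odd j).
have -> : ev u ('X ^+ i * (1 - 'X) ^+ j) = w * g * w.
  rewrite -!evM; congr (ev u _); rewrite -{1}(odd_double_half i) -{1}(odd_double_half j).
  by rewrite -!addnn !exprD; ring.
have -> : star h * (w * g * w) * h = star (w * h) * g * (w * h).
  by rewrite starM (star_ev _ su) !mulrA.
move: (w * h) => y; rewrite /g evM !evXn evB ev1 evX.
case: (odd i) (odd j) => [] []; rewrite ?expr1 ?expr0 ?mulr1 ?mul1r //.
exact: rtau_ge0.
Qed.

Lemma sqrt_error_limit h (eps : R) : 0 < eps -> exists n,
  rtau (star h * ev u (sqrt_error n ^+ 2) * h) <= eps.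
Proof.
move=> e0; pose S p := rtau (star h * ev u p * h).
have SD p q : S (p + q) = S p + S q by rewrite /S evD mulrDr mulrDl rtauD.
have SZ d p : S (d *: p) = d * S p by rewrite /S evZ -scalerAr -scalerAl rtauZ.
have bnd := sqrt_error_small SD SZ (cone_rtau_ge0 h).
apply: contrapT => /forallNP ne.
have {}ne n : eps <= S (sqrt_error n ^+ 2).
  by rewrite leNgt; apply/negP => /ltW; exact: ne.
have lin N : N%:R * eps <= 2 * S 'X.
  apply: le_trans (bnd N); rewrite mulr_natl -[X in _ *+ X]card_ord -sumr_const.
  by apply: ler_sum => i _.
have /archi_boundP hb : 0 <= `|2 * S 'X| / eps by rewrite divr_ge0// ltW.
move: hb; rewrite ltr_pdivrMr// => hb.
have := lt_le_trans hb (lin _); rewrite ltNge ler_norm; exact.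
Qed.

(** Replace u by its approximation, a polynomial in u^2: the approximation contributes
    nothing by hypothesis, and the error is controlled by Cauchy-Schwarz. *)
Lemma rtau_sqrt_density Y :
  (forall p, rtau (horner_alg (u ^+ 2) p * Y) = 0) ->
  forall p, rtau (horner_alg (u ^+ 2) p * u * Y) = 0.
Proof.
move=> h0 p; set o := horner_alg _ p; set t := rtau _.
have tE n : t = rtau (star (ev u (sqrt_error n) * star o) * Y).
  have cm : o * ev u (sqrt_error n) = ev u (sqrt_error n) * o.
    by rewrite /o -[u ^+ 2]horner_algXn horner_alg_comp /ev -!rmorphM mulrC.
  rewrite starM starK (star_ev _ su) /t /sqrt_error evB evX mulrBr mulrBl rtauD rtauN.
  suff -> : rtau (o * ev u (sqrt_approx n \Po 'X^2) * Y) = 0 by rewrite subr0.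
  have -> : ev u (sqrt_approx n \Po 'X^2) =
      horner_alg (u ^+ 2) (map_poly (real_complex R) (sqrt_approx n)).
    by rewrite /ev map_comp_poly map_polyXn -horner_alg_comp horner_algXn.
  by rewrite /o -rmorphM h0.
have K0 : 0 <= rtau (star Y * Y) by exact: rtau_ge0.
apply/eqP; rewrite -(sqrf_eq0 t); apply/eqP/le_anti; rewrite sqr_ge0 andbT.
rewrite leNgt; apply/negP => t0.
(* With this bound Cauchy-Schwarz would give t ^ 2 <= t ^ 2 / 2. *)
pose eps := t ^+ 2 / (2 * (rtau (star Y * Y) + 1)).
have eps0 : 0 < eps by rewrite divr_gt0//; lra.
have [n hn] := sqrt_error_limit (star o) eps0.
have := rtau_CS state (ev u (sqrt_error n) * star o) Y.
rewrite -tE leNgt => /negP; apply.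
have eN : rtau (star (ev u (sqrt_error n) * star o) * (ev u (sqrt_error n) * star o)) <= eps.
  move: hn; rewrite evXn starM (star_ev _ su) expr2; congr (rtau _ <= _).
  by rewrite !mulrA.
apply: le_lt_trans (ler_wpM2r K0 eN) _.
rewrite /eps mulrAC ltr_pdivrMr; last lra.
by nra.
Qed.

End PositiveContraction.

(** A polynomial in b is an even part plus b times an even part.  After rescaling b
    into [0, 1], the moment bound gives the contraction property and the odd part
    is reached by approximation. *)
Lemma square_density c b M Y : 0 < M -> b = star c * c ->
  (forall n, rtau ((b ^+ 2) ^+ n) <= (M ^+ 2) ^+ n) ->
  (forall p, tau (horner_alg (b ^+ 2) p * Y) = 0) ->
  forall q, tau (horner_alg b q * Y) = 0.
Proof.
move=> M0 bE mom h0 q.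
pose u := M^-1%:C *: b; pose d := (Num.sqrt M^-1)%:C *: c.
have uE : u = star d * d.
  rewrite /u /d star_real -scalerAl -scalerAr scalerA -rmorphM /= -expr2.
  by rewrite sqr_sqrtr ?invr_ge0 ?ltW// bE.
have um n : rtau (u ^+ (2 * n)) <= 1.
  rewrite exprM /u exprZn -rmorphXn /= exprZn -rmorphXn /= rtauZ.
  rewrite -exprM exprVn exprM ler_pdivrMl ?exprn_gt0// mulr1; exact: mom.
have bu : b = M%:C *: u.
  by rewrite /u scalerA -rmorphM /= divff ?gt_eqF// scale1r.
have key Z : (forall p, tau (horner_alg (b ^+ 2) p * Z) = 0) ->
    rtau (horner_alg b q * Z) = 0.
  move=> hZ; have hZu p : rtau (horner_alg (u ^+ 2) p * Z) = 0.
    have -> : u ^+ 2 = horner_alg (b ^+ 2) ((M^-1%:C ^+ 2) *: 'X).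
      by rewrite linearZ /= mulr_algl horner_algX /u exprZn.
    by rewrite horner_alg_comp rtau_ker.
  rewrite -(poly_even_odd q) rmorphD rmorphM /= horner_algX -!horner_alg_comp.
  rewrite !horner_algXn mulrDl rtauD (rtau_ker (hZ _)) add0r {2}bu.
  rewrite -scalerAr -scalerAl rtauZ.
  have -> : b ^+ 2 = horner_alg (u ^+ 2) ((M%:C ^+ 2) *: 'X).
    by rewrite linearZ /= mulr_algl horner_algX bu exprZn.
  by rewrite horner_alg_comp (rtau_sqrt_density uE um hZu) mulr0.
apply: tau_eq0; first exact: key.
have := key ('i *: Y); rewrite -scalerAr; apply => p.
by rewrite -scalerAr linearZ /= h0 mulr0.
Qed.

End Density.

(** * S-transform of a free multiplicative power *)
Section Convolution.
Variables (R : realType) (A : cstarAlgType R) (tau : {scalar A}).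
Hypothesis state : tracial_state tau.
Variables (I : eqType) (a b : I -> A) (M : R).
Hypothesis M0 : 0 < M.
Hypothesis freea : free_elements tau a.
Hypothesis b_pos : forall i, cstar_positive (b i).
Hypothesis ba : forall i, b i ^+ 2 = a i.
Hypothesis mom : forall i n, rtau tau (a i ^+ n) <= (M ^+ 2) ^+ n.

Let tau1 : tau 1 = 1. Proof. by case: state. Qed.

(** The letters are replaced one at a time, from the left.  With all other letters of
    the word fixed, the trace is a functional x |-> tau (x Y), and by
    [square_density] a property of this functional on the polynomials in a_i extends
    to the polynomials in b_i. *)
Lemma mixed_word_ker (pre post : seq (I * A)) :
  sorted (fun p q => p.1 != q.1) (pre ++ post) -> pre ++ post != [::] ->
  (forall p, p \in pre -> centered tau (b p.1) p.2) ->
  (forall p, p \in post -> centered tau (a p.1) p.2) ->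
  tau (word_value (pre ++ post)) = 0.
Proof.
elim/last_ind: pre post => [|pre [i x] IH] post.
  move=> /= spost post0 _ hpost; apply: (tau_alternating freea) => //; split=> //.
rewrite cat_rcons => sw _ hpre hpost.
have [[q _ qx] /= tx] : centered tau (b i) x.
  by apply: (hpre (i, x)); rewrite mem_rcons inE eqxx.
pose Y := word_value post * word_value pre.
have wE (y : A) : tau (word_value (pre ++ (i, y) :: post)) = tau (y * Y).
  by rewrite /word_value big_cat big_cons /= (tauC state) -mulrA.
have kerA y : centered tau (a i) y -> tau (y * Y) = 0.
  move=> cy; rewrite -wE; apply: (IH ((i, y) :: post)).
  - have srt (w : seq (I * A)) : sorted (fun p q => p.1 != q.1) w =
        sorted (fun j k => j != k) [seq p.1 | p <- w] by rewrite sorted_map.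
    by move: sw; rewrite !srt !map_cat.
  - by case: (pre).
  - by move=> p pp; apply: hpre; rewrite mem_rcons inE pp orbT.
  - by move=> p; rewrite inE => /predU1P[->|/hpost].
(* Subtracting tau Y makes the functional vanish on scalars too, hence on all
   polynomials in a_i, not only on the centred ones. *)
have kerB : forall p, tau (horner_alg (b i ^+ 2) p * (Y - (tau Y)%:A)) = 0.
  move=> p; rewrite ba; set y := horner_alg _ p.
  have cy : centered tau (a i) (y - (tau y)%:A).
    split; last by rewrite linearB linearZ /= tau1 mulr1 subrr.
    by apply: gen_subalgebraB; exists p.
  rewrite mulrBr -scalerAr mulr1 linearB linearZ /=.
  have := kerA _ cy; rewrite mulrBl -scalerAl mul1r linearB linearZ /= => /eqP.
  by rewrite subr_eq0 => /eqP ->; rewrite mulrC subrr.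
have [c bc] := b_pos i.
have momb n : rtau tau ((b i ^+ 2) ^+ n) <= (M ^+ 2) ^+ n by rewrite ba.
have := square_density state M0 bc momb kerB q; rewrite qx.
rewrite mulrBr -scalerAr mulr1 linearB linearZ /= tx mulr0 subr0 => <-.
exact: wE.
Qed.

Lemma free_square_roots : free_elements tau b.
Proof.
move=> m i x m0 hx ine.
pose w := [seq (i j, x j) | j <- iota 0 m].
have -> : \prod_(j < m) x j = word_value (w ++ [::]).
  by rewrite cats0 /word_value big_map -(big_mkord xpredT) /index_iota subn0.
apply: mixed_word_ker.
- rewrite cats0; apply/(sortedP (i 0, x 0)) => j; rewrite size_map size_iota => jm.
  rewrite !(nth_map 0)/= ?size_iota ?(ltn_trans (ltnSn j))// !nth_iota ?(ltn_trans (ltnSn j))//.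
  by rewrite !add0n; apply/eqP; exact: ine.
- by rewrite cats0 /w; case: (m) m0.
- move=> p /mapP[j]; rewrite mem_iota add0n => jm -> /=; exact: hx.
- by [].
Qed.

Definition sandwich (s : seq I) : A := \prod_(i <- s) b i * \prod_(i <- rev s) b i.

Lemma sandwich_cons i s : sandwich (i :: s) = b i * sandwich s * b i.
Proof. by rewrite /sandwich rev_cons big_cons -cats1 big_cat big_seq1 /= !mulrA. Qed.

Lemma tau_sandwich_cons i s m :
  tau (sandwich (i :: s) ^+ m) = tau ((a i * sandwich s) ^+ m).
Proof.
rewrite sandwich_cons; set D := sandwich s; case: m => [|m]; first by rewrite !expr0.
have e : (b i * D * b i) ^+ m.+1 = b i * D * (a i * D) ^+ m * b i.
  elim: m => [|m IHm]; first by rewrite expr1 expr0 mulr1.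
  rewrite exprSr IHm [(a i * D) ^+ m.+1]exprSr -(ba i) expr2.
  by rewrite !mulrA.
by rewrite e (tauC state) exprS -(ba i) expr2 !mulrA.
Qed.

(** Group the indices into i and the others: the sandwich over s is a product of
    letters with indices different from i. *)
Lemma free_sandwich i s : i \notin s ->
  free_elements tau (fun t : bool => if t then a i else sandwich s).
Proof.
move=> is_; pose C (t : bool) := gen_subalgebra (if t then a i else sandwich s).
apply: (free_grouping (B := fun i => gen_subalgebra (b i)) (pi := fun j => j == i)
   (C := C) free_square_roots).
move=> [] x [p _ px] tx.
  apply: lspan_base; exists [:: (i, x)]; split=> /=.
  - apply: alternating_cons => //.
    rewrite -px -(ba i) -(horner_algXn (b i)) horner_alg_comp.
    by exists (p \Po 'X^2).
  - by rewrite eqxx.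
  - by rewrite /word_value big_seq1.
have := @full_centered _ _ _ tau1 _ (fun i => gen_subalgebra (b i))
  (fun j => j != i) x free_square_roots.
move=> /(_ _ tx) h; apply: lspan_sub (h _).
  move=> y [w [aw /andP[w0 hw] ->]]; apply: lspan_base; exists w; split=> //; rewrite w0 /=.
  by apply: sub_all hw => q; case: eqP.
have fp (r : seq I) y : i \notin r ->
    lspan (words tau (fun i => gen_subalgebra (b i)) (all (fun p => p.1 != i))) y ->
    lspan (words tau (fun i => gen_subalgebra (b i)) (all (fun p => p.1 != i)))
      (\prod_(j <- r) b j * y).
  move=> ir; apply: (full_prod tau1 (J := fun j => j != i)).
  - by move=> j; exact: gen_subalgebraM.
  - by move=> j ? c; exact: gen_subalgebraB.
  move=> j jr; split; first by apply: contraNneq ir => <-.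
  by exists 'X; rewrite ?horner_algX.
rewrite -px; apply: (full_horner (J := fun j => j != i)).
by move=> y fy; rewrite /sandwich -mulrA; apply: (fp s) => //; apply: (fp (rev s)); rewrite ?mem_rev.
Qed.

Lemma S_transform_sandwich N S (s : seq I) :
  (forall i, i \in s -> S_transform N (fun m => tau (a i ^+ m)) S) ->
  uniq s -> s != [::] ->
  S_transform N (fun m => tau (sandwich s ^+ m)) (S ^+ size s).
Proof.
elim: s => // i s IHs hS /= /andP[is_ us] _.
have -> : (fun m => tau (sandwich (i :: s) ^+ m)) = (fun m => tau ((a i * sandwich s) ^+ m)).
  by apply/funext => m; exact: tau_sandwich_cons.
have Si := hS i (mem_head _ _).
case: s IHs hS is_ us => [|j s] IHs hS is_ us.
  rewrite expr1 /sandwich !big_nil mulr1.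
  by have -> : (fun m => tau ((a i * 1) ^+ m)) = (fun m => tau (a i ^+ m)) by
    apply/funext => m; rewrite mulr1.
rewrite exprS; apply: S_transform_mul => //; first exact: free_sandwich.
by apply: IHs => // l ls; apply: hS; rewrite inE ls orbT.
Qed.

End Convolution.

Lemma sandwich_enum (R : realType) (A : cstarAlgType R) k (b : 'I_k -> A) :
  \prod_(i < k) b i * \prod_(i < k) b (rev_ord i) = sandwich b (enum 'I_k).
Proof.
have eE (f : 'I_k -> A) : \prod_(i <- enum 'I_k) f i = \prod_(i < k) f i.
  by rewrite enumT [index_enum _]unlock.
have rE : rev (enum 'I_k) = [seq rev_ord i | i <- enum 'I_k].
  case: k b eE => [|k] b eE; first by rewrite !(size0nil (size_enum_ord 0)).
  apply: (@eq_from_nth _ ord0); first by rewrite size_rev size_map.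
  rewrite size_rev size_enum_ord => j jk.
  rewrite nth_rev ?size_enum_ord// (nth_map ord0) ?size_enum_ord//.
  by apply: val_inj; rewrite /= !nth_enum_ord//; lia.
rewrite /sandwich rE; congr (_ * _); first exact: (esym (eE b)).
by rewrite big_map; exact: (esym (eE (fun i => b (rev_ord i)))).
Qed.

Section FreePower.
Variables (R : realType) (mu : probability (measurableTypeR R) R) (M : R).
Hypothesis M0 : 0 < M.
Hypothesis mom : forall n, moment mu n <= (M ^+ 2) ^+ n.

Lemma S_transform_free_power N k S nu : (0 < k)%N ->
  S_transform N (fun m => (moment mu m)%:C) S ->
  is_free_mult_power mu k nu ->
  S_transform N (fun m => (moment nu m)%:C) (S ^+ k).
Proof.
move=> k0 muS [_ [A [tau [a [b [st fa ha hb hnu]]]]]].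
have -> : (fun m => (moment nu m)%:C) = (fun m => tau (sandwich b (enum 'I_k) ^+ m)).
  by apply/funext => m; rewrite hnu sandwich_enum.
rewrite -[X in S ^+ X](size_enum_ord k).
apply: (S_transform_sandwich st M0 fa) => //.
- by move=> i; case: (hb i).
- by move=> i; case: (hb i).
- by move=> i n; rewrite /rtau (ha i).2 /=; exact: mom.
- move=> i _; have -> // : (fun m => tau (a i ^+ m)) = (fun m => (moment mu m)%:C).
  by apply/funext => m; rewrite (ha i).2.
- exact: enum_uniq.
- by rewrite -size_eq0 size_enum_ord -lt0n.
Qed.

End FreePower.

(** * Positivity of the coefficients *)
Section Positivity.
Variable K : archiRealFieldType.
Implicit Types (C T q : {poly K}) (c : nat -> K).

(** binomial(k, j + 1) / binomial(k, j) = (k - j) / (j + 1) is at least B in this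
    range. *)
Lemma binomial_dominates B j k i : (0 < B)%N -> (i < j)%N -> (j + B * j <= k)%N ->
  (B * 'C(k, i) <= 'C(k, j))%N.
Proof.
move=> B0; elim: j => // j IHj ij hk.
have step : (B * 'C(k, j) <= 'C(k, j.+1))%N.
  have := mul_bin_left k j => e.
  rewrite -(leq_pmul2l (m := j.+1))// e mulnA leq_mul2r; apply/orP; right.
  by have : (B * j.+1 = B * j + B)%N by [rewrite mulnS addnC]; nia.
move: ij; rewrite ltnS leq_eqVlt => /predU1P[->//|ij].
apply: leq_trans step; apply: leq_trans (IHj ij _) _; first by nia.
exact: leq_pmull.
Qed.

Lemma binomial_sum_ge0 c j : 0 < c j -> exists N, forall k, (N <= k)%N ->
  0 <= \sum_(i < j.+1) c i *+ 'C(k, i).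
Proof.
move=> cj; pose s := \sum_(i < j) `|c i|.
have s0 : 0 <= s by apply: sumr_ge0.
(* For i < j each binomial coefficient is at most 1 / B times the last one, so the
   lower terms amount to at most (s / B) binomial(k, j). *)
pose B := (Num.bound (s / c j)).+1.
have sB : s <= B%:R * c j.
  have := archi_boundP (divr_ge0 s0 (ltW cj)); rewrite ltr_pdivrMr// => h.
  by apply: le_trans (ltW h) _; rewrite ler_wpM2r ?(ltW cj)// ler_nat /B leqnSn.
exists (j + B * j)%N => k hk; rewrite big_ord_recr /=.
suff : \sum_(i < j) `|c i| *+ 'C(k, i) <= c j *+ 'C(k, j).
  have : - (\sum_(i < j) `|c i| *+ 'C(k, i)) <= \sum_(i < j) c i *+ 'C(k, i).
    rewrite -sumrN; apply: ler_sum => i _; rewrite -mulNrn lerMn2r.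
    by rewrite lerNl -normrN ler_norm orbT.
  by move=> h1 h2; have := lerD h1 h2; rewrite addNr.
have Bp : 0 < B%:R :> K by rewrite ltr0n.
rewrite -(ler_pM2l Bp) mulr_sumr.
apply: (@le_trans _ _ (\sum_(i < j) `|c i| *+ 'C(k, j))).
  apply: ler_sum => i _; rewrite -[_ *+ 'C(k, i)]mulr_natl -[_ *+ 'C(k, j)]mulr_natl.
  rewrite mulrA -natrM ler_wpM2r// ler_nat; exact: binomial_dominates.
by rewrite sumrMnl mulrnAr lerMn2r sB orbT.
Qed.

(** Factor T = T_0 (1 + z Q) and expand (1 + z Q)^k by the binomial formula: the term
    i contributes to degree j for i <= j only, and the dominating term i = j
    carries the positive coefficient Q_0^j. *)
Lemma powers_coef_ge0 T j : 0 < T`_0 -> 0 < T`_1 -> exists N, forall k, (N <= k)%N ->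
  0 <= (T ^+ k)`_j.
Proof.
move=> T0 T1; pose Q := (T`_0)^-1 *: drop_poly 1 T.
have TE : T = (T`_0) *: (1 + 'X * Q).
  apply/polyP => -[|i]; rewrite coefZ coefD coef1 coefXM/= ?addr0 ?mulr1//.
  by rewrite add0r /Q coefZ coef_drop_poly addn1 mulrA divff ?gt_eqF// mul1r.
pose c i := (('X * Q) ^+ i)`_j.
have cj : 0 < c j.
  rewrite /c exprMn coefXnM ltnn subnn -horner_coef0 horner_exp horner_coef0.
  by rewrite exprn_gt0// /Q coefZ coef_drop_poly mulr_gt0// invr_gt0.
have [N hN] := binomial_sum_ge0 cj.
exists (maxn N j) => k; rewrite geq_max => /andP[Nk jk].
rewrite TE exprZn coefZ; apply: mulr_ge0; first exact/exprn_ge0/ltW.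
rewrite exprDn coef_sum.
suff <- : \sum_(i < j.+1) c i *+ 'C(k, i) =
    \sum_(i < k.+1) (1 ^+ (k - i) * ('X * Q) ^+ i *+ 'C(k, i))`_j by exact: hN.
rewrite -(big_mkord xpredT (fun i => c i *+ 'C(k, i))).
rewrite -(big_mkord xpredT (fun i => (1 ^+ (k - i) * ('X * Q) ^+ i *+ 'C(k, i))`_j)).
rewrite [RHS](big_cat_nat _ (n := j.+1))//= [X in _ + X]big_nat_cond [X in _ + X]big1 ?addr0.
  by apply: eq_bigr => i _; rewrite expr1n mul1r coefMn.
move=> i; rewrite andbT => /andP[ji _]; rewrite expr1n mul1r coefMn exprMn coefXnM.
by rewrite ji mul0rn.
Qed.

Lemma powers_coefs_ge0 T n : 0 < T`_0 -> 0 < T`_1 -> exists N, forall k, (N <= k)%N ->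
  forall j, (j < n)%N -> 0 <= (T ^+ k)`_j.
Proof.
move=> T0 T1; elim: n => [|n [N1 h1]]; first by exists 0.
have [N2 h2] := powers_coef_ge0 n T0 T1.
exists (maxn N1 N2) => k; rewrite geq_max => /andP[k1 k2] j.
by rewrite ltnS leq_eqVlt => /predU1P[->|]; [exact: h2|exact: h1].
Qed.

Lemma coef_exp_nneg q : (forall l, 0 <= q`_l) -> forall i l, 0 <= (q ^+ i)`_l.
Proof.
move=> q0; elim=> [|i IHi] l; first by rewrite expr0 coef1 ler0n.
by rewrite exprS coefM; apply: sumr_ge0 => a _; rewrite mulr_ge0.
Qed.

Lemma fixpoint_ge0 n C T : C`_0 = 0 -> C =X_n.+1 'X * (T \Po C) ->
  (forall j, (j < n)%N -> 0 <= T`_j) -> forall j, (j <= n)%N -> 0 <= C`_j.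
Proof.
move=> C0 CE T0; elim/ltn_ind => -[|j] IH jn; first by rewrite C0.
rewrite CE// coefXM /= (comp_trunc (n := j.+1) T C0)// coef_sum; apply: sumr_ge0 => i _.
rewrite coefZ mulr_ge0//; first by apply: T0; have := ltn_ord i; lia.
have Ct : C =X_j.+1 take_poly j.+1 C by move=> l ll; rewrite coef_take_poly ll.
have Cti := eqX_exp i Ct; rewrite (Cti j)//; apply: coef_exp_nneg => l.
rewrite coef_take_poly; case: ltnP => // lj.
by apply: IH => //; lia.
Qed.

End Positivity.

(** * Moments of a measure on [0, L] *)
Lemma integral_full_measure (d : measure_display) (T : measurableType d) (R : realType)
    (P : probability T R) (I : set T) (f : T -> R) :
  measurable I -> P I = 1%E -> measurable_fun setT f ->
  (\int[P]_x (f x)%:E = \int[P]_(x in I) (f x)%:E)%E.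
Proof.
move=> mI PI mf; have mfE : measurable_fun setT (EFin \o f) by exact/measurable_EFinP.
rewrite [RHS]integral_mkcond; apply: ae_eq_integral => //.
  by apply/(measurable_restrictT _ mI); exact: measurable_funS mfE.
have PC : P (~` I)%classic = 0%E by rewrite probability_setC// PI subee.
exists (~` I)%classic; split=> //; first exact: measurableC.
move=> x /= nfx xI; apply: nfx => _; rewrite patchE ifT//.
exact/mem_set.
Qed.

Section MeasureFacts.
Variables (R : realType) (mu : probability (measurableTypeR R) R) (L : R).
Hypothesis mu_supp : supported_in mu `[0, L]%classic.
Let I : set (measurableTypeR R) := `[0, L]%classic.

Let mI : measurable I. Proof. exact: measurable_itv. Qed.

Let muI : mu I = 1%E. Proof. exact: mu_supp. Qed.

Let inI (x : R) : I x -> 0 <= x <= L.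
Proof. by move=> Ix; have : x \in `[0, L]%R := Ix; rewrite in_itv. Qed.

Lemma L_ge0 : 0 <= L.
Proof.
rewrite leNgt; apply/negP => L0; have := mu_supp; rewrite /supported_in.
rewrite set_itv_ge; last by rewrite bnd_simp -ltNge.
by rewrite measure0 => /eqP; rewrite eq_sym onee_eq0.
Qed.

Lemma integrable_supp n : mu.-integrable I (EFin \o (fun x : measurableTypeR R => (x : R) ^+ n)).
Proof.
have mufin : (mu I < +oo)%E by rewrite muI ltry.
apply: measurable_bounded_integrable => //.
exists (L ^+ n); split; first exact: num_real.
move=> B LB x /inI /andP[x0 xL] /=.
rewrite normrX ger0_norm//; apply: le_trans (ltW LB); rewrite lerXn2r ?nnegrE ?(le_trans x0 xL)//.
Qed.

Lemma momentE n : moment mu n = \int[mu]_(x in I) ((x : R) ^+ n).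
Proof.
by congr fine; apply: integral_full_measure.
Qed.

Let Rintegral_supp_cst (r : R) : \int[mu]_(x in I) r = r.
Proof.
by rewrite Rintegral_cst// -[RHS]mulr1; congr (_ * _); exact: (congr1 fine muI).
Qed.

Lemma moment0 : moment mu 0 = 1.
Proof. by rewrite momentE -[RHS]Rintegral_supp_cst. Qed.

Lemma moment_le n : moment mu n <= L ^+ n.
Proof.
rewrite momentE -[leRHS]Rintegral_supp_cst.
apply: le_Rintegral => //; first exact: integrable_supp.
  by apply: finite_measure_integrable_cst.
by move=> x /inI /andP[x0 xL]; rewrite lerXn2r ?nnegrE ?(le_trans x0 xL)//.
Qed.

Lemma moment_ge0 n : 0 <= moment mu n.
Proof.
rewrite momentE; apply: Rintegral_ge0 => x /inI /andP[x0 _].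
exact: exprn_ge0.
Qed.

Lemma moment1_mean alpha : ('E_mu[(fun x : R => x)] = alpha%:E)%E -> moment mu 1 = alpha.
Proof. by rewrite unlock /moment /Rintegral; under eq_integral do rewrite -[X in X%:E]expr1; move=> ->. Qed.

Lemma moment2_variance alpha sigma : ('E_mu[(fun x : R => x)] = alpha%:E)%E ->
  ('V_mu[(fun x : R => x)] = (sigma ^+ 2)%:E)%E -> moment mu 2 = sigma ^+ 2 + alpha ^+ 2.
Proof.
move=> muE; have m1 := moment1_mean muE.
rewrite /variance covariance.unlock muE expectation.unlock => /(congr1 fine) /= muV.
pose g (x : measurableTypeR R) : R := (x : R) ^+ 2 + (- 2 * alpha * (x : R) ^+ 1 + alpha ^+ 2).
have gE : fine (\int[mu]_x (g x)%:E)%E = sigma ^+ 2.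
  rewrite -muV; congr fine; apply: eq_integral => x _; congr EFin; rewrite /g /=.
  by rewrite -[RHS]/(((x : R) - alpha) * ((x : R) - alpha)); ring.
have mg : measurable_fun setT g.
  apply: measurable_funD; first exact: exprn_measurable.
  apply: measurable_funD => //; apply: measurable_funM => //; exact: exprn_measurable.
have intc (r : R) : mu.-integrable I (EFin \o (fun=> r)).
  exact: finite_measure_integrable_cst.
have intl : mu.-integrable I (EFin \o (fun x : measurableTypeR R => - 2 * alpha * (x : R) ^+ 1)).
  by have := integrableZl mI (- 2 * alpha) (integrable_supp 1).
have : \int[mu]_(x in I) g x = sigma ^+ 2.
  by rewrite -gE; congr fine; rewrite -integral_full_measure.
rewrite /g RintegralD//; [|exact: integrable_supp|]; last first.
  exact: (integrableD mI intl (intc _)).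
rewrite RintegralD// RintegralZl//; last exact: integrable_supp.
rewrite Rintegral_supp_cst -!momentE m1 => <-.
by ring.
Qed.

End MeasureFacts.

(** * Cumulants of free powers *)
Section Assembly.
Variable R : realType.
Local Notation rc := (real_complex R).
Implicit Types (S T : {poly R}) (m : nat -> R) (mu nu : probability (measurableTypeR R) R).

Lemma map_series N m : map_poly rc (series N m) = series N (fun i => (m i)%:C).
Proof.
by apply/polyP => i; rewrite coef_map !coef_poly; case: ifP; rewrite ?rmorph0.
Qed.

Lemma eqX_map n (p q : {poly R}) : map_poly rc p =X_n map_poly rc q <-> p =X_n q.
Proof.
split=> h i il; last by rewrite !coef_map h.
by apply: complexI; have := h i il; rewrite !coef_map.
Qed.

Lemma S_transform_map N m S : S_transform N m S ->
  S_transform N (fun i => (m i)%:C) (map_poly rc S).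
Proof.
move=> [sg <- sgE]; exists (map_poly rc sg).
  by rewrite rmorphM rmorphD rmorph1 /= map_polyX.
rewrite -map_series -{1}(map_polyX rc) -rmorphM -map_comp_poly.
have -> : 1 + 'X = map_poly rc (1 + 'X) by rewrite rmorphD rmorph1 /= map_polyX.
exact/eqX_map.
Qed.

(** The value 1 at 0 turns the cumulant series into C = 1 + K. *)
Definition cumulant_seq nu (j : nat) : R := if j == 0%N then 1 else free_cumulant nu j.

Lemma cumulant_series_S N nu S : moment nu 0 = 1 ->
  S_transform N (fun i => (moment nu i)%:C) (map_poly rc S) ->
  series N (cumulant_seq nu) \Po ('X * S) =X_N.+1 1 + 'X.
Proof.
move=> m0 nuS; apply/eqX_map.
rewrite map_comp_poly rmorphM rmorphD rmorph1 /= map_polyX map_series.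
apply: cumulant_S_transform nuS; rewrite ?m0 ?rmorph1//= => n n0.
rewrite free_cumulantP// rmorph_sum; apply: eq_bigr => P PN.
rewrite rmorph_prod; apply: eq_bigr => V VP; congr _%:C.
rewrite /cumulant_seq ifN// -lt0n card_gt0.
by move: PN; rewrite inE => /andP[/partition_neq0/(_ VP)].
Qed.

Lemma cumulants_ge0 N nu S T n : (n <= N)%N -> moment nu 0 = 1 ->
  S_transform N (fun i => (moment nu i)%:C) (map_poly rc S) ->
  S`_0 != 0 -> S * T =X_N.+1 1 -> (forall j, (j < n)%N -> 0 <= T`_j) ->
  forall j, (1 <= j <= n)%N -> 0 <= free_cumulant nu j.
Proof.
move=> nN m0 nuS S0 ST T0 j /andP[j1 jn].
pose C := series N (cumulant_seq nu) - 1.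
have C0 : C`_0 = 0 by rewrite coefB coef_poly coef1 subrr.
have CS : C \Po ('X * S) =X_N.+1 'X.
  rewrite comp_polyB comp_polyC (cumulant_series_S m0 nuS).
  by rewrite addrAC subrr add0r.
have CE := T_transform_fixpoint C0 S0 ST CS.
have := fixpoint_ge0 C0 (eqXW (leq_ltn_trans nN (ltnSn N)) CE) T0 jn.
rewrite coefB coef_poly coef1 ltnS (leq_trans jn nN) /cumulant_seq.
by case: j j1 jn => // j _ _; rewrite subr0.
Qed.

Lemma free_power_moment0 mu k nu : is_free_mult_power mu k nu -> moment nu 0 = 1.
Proof.
move=> [_ [A [tau [a [b [[tau1 _ _] _ _ _ /(_ 0)]]]]]].
by rewrite expr0 tau1 => /complexI.
Qed.

(** The square of the seminorm of b_i is the trace of a_i, so if this vanishes then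
    Cauchy-Schwarz kills the trace of every product a_i Z. *)
Lemma free_power_mean0 mu k nu : (0 < k)%N -> moment mu 1 = 0 ->
  is_free_mult_power mu k nu -> forall n, (0 < n)%N -> moment nu n = 0.
Proof.
move=> k0 mu1 [_ [A [tau [a [b [st fa ha hb hnu]]]]]] [//|n] _.
apply: (@complexI R); rewrite hnu sandwich_enum.
case E : (enum 'I_k) => [|i s].
  by have := size_enum_ord k; rewrite E /= => k00; rewrite -k00 in k0.
have ba l : b l ^+ 2 = a l by case: (hb l).
rewrite (tau_sandwich_cons st ba) exprS -mulrA; set Y := _ * _ ^+ _.
have aY Z : rtau tau (a i * Z) = 0.
  have [c bE] := (hb i).1.
  have sb : star (b i) = b i by rewrite bE starM starK.
  have := rtau_CS st (b i) (b i * Z); rewrite sb mulrA -expr2 ba.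
  rewrite {2}/rtau -[a i]expr1 (ha i).2 mu1 /= mul0r expr1 => h.
  by apply/eqP; rewrite -sqrf_eq0; apply/eqP/le_anti; rewrite h sqr_ge0.
by apply: tau_eq0; rewrite ?scalerAr aY.
Qed.

Lemma cumulants_moment0 nu : (forall n, (0 < n)%N -> moment nu n = 0) ->
  forall n, (0 < n)%N -> free_cumulant nu n = 0.
Proof.
move=> m0 n n0; rewrite -(@free_cumulant_unique _ nu (fun=> 0))// => l l0.
rewrite m0// big1// => P; rewrite inE => /andP[/cover_partition cP _].
have [V VP] : exists V, V \in P.
  apply/set0Pn/eqP => P0; move: cP; rewrite P0 /finset.cover big_set0 => /setP.
  by move/(_ (Ordinal l0)); rewrite !inE.
by rewrite (bigD1 V VP)/= mul0r.
Qed.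

(** The seminorm of a_i - alpha vanishes, so a_i can be replaced by alpha next to a
    power of a_i. *)
Lemma free_power_point_mass mu k nu : (0 < k)%N -> moment mu 0 = 1 ->
  moment mu 2 = moment mu 1 ^+ 2 ->
  is_free_mult_power mu k nu -> forall n, moment mu n.+1 = moment mu 1 * moment mu n.
Proof.
move=> k0 mu0 mu2 [_ [A [tau [a [b [st fa ha hb _]]]]]] n.
pose i := Ordinal k0; pose al := moment mu 1; pose d := a i - al%:C%:A.
have ai l : rtau tau (a i ^+ l) = moment mu l by rewrite /rtau (ha i).2.
have [c aE] := (ha i).1.
have sa : star (a i) = a i by rewrite aE starM starK.
have sd : star d = d by rewrite starD starN star_real star1 sa.
have d2 : rtau tau (star d * d) = 0.
  have r2 : rtau tau (a i * a i) = al ^+ 2 by rewrite -expr2 ai mu2.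
  have r1 : rtau tau (a i) = al by have := ai 1%N; rewrite expr1.
  have r0 : rtau tau 1 = 1 by have := ai 0; rewrite expr0 mu0.
  have ad x : rtau tau (x * d) = rtau tau (x * a i) - al * rtau tau x.
    by rewrite /d mulrBr -scalerAr mulr1 rtauD rtauN rtauZ.
  rewrite sd {1}/d mulrBl -scalerAl mul1r rtauD rtauN rtauZ ad r2 r1.
  have -> : rtau tau d = 0 by rewrite -[d]mul1r ad mul1r r1 r0 mulr1 subrr.
  by rewrite mulr0 subr0 expr2 subrr.
have h : rtau tau (star d * a i ^+ n) = 0.
  apply/eqP; rewrite -sqrf_eq0; apply/eqP/le_anti; rewrite sqr_ge0 andbT.
  by rewrite -[leRHS](mul0r (rtau tau (star (a i ^+ n) * a i ^+ n))) -d2; exact: rtau_CS.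
move: h; rewrite sd /d mulrBl -scalerAl mul1r -exprS rtauD rtauN rtauZ !ai.
by move/eqP; rewrite subr_eq0 => /eqP.
Qed.

(** The moment series satisfies M = 1 + z m_1 M; substitute z S(z) / (1 + z). *)
Lemma S_transform_geometric N m S : m 0 = 1 -> (forall n, m n.+1 = m 1 * m n) ->
  S_transform N m S -> m 1 *: S =X_N 1.
Proof.
move=> m0 mS [sg <- sgE]; set u := 'X * sg in sgE.
have u0 : u`_0 = 0 by rewrite coefXM.
have sE : series N m =X_N.+1 1 + 'X * ((m 1)%:P * series N m).
  move=> i il; rewrite coefD coefXM coef1 coefCM !coef_poly il.
  case: i il => [|i] il /=; first by rewrite m0 addr0.
  have iN : (i < N.+1)%N by lia.
  by rewrite add0r iN; exact: mS.
apply: eqX_XMI; have := eqX_comp u0 u0 sE (eqX_refl u).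
rewrite comp_polyD !comp_polyM !comp_polyC comp_polyX sgE => h.
rewrite mulr1 -mul_polyC.
have -> : 'X * ((m 1)%:P * ((1 + 'X) * sg)) = u * ((m 1)%:P * (1 + 'X)) by rewrite /u; ring.
have := eqXD h (eqX_refl (n := N.+1) (- 1)).
by rewrite polyC1 ![1 + _ - 1]addrAC subrr !add0r; exact: eqX_sym.
Qed.

End Assembly.

Local Close Scope complex_scope.
Unset Implicit Arguments.
Set Strict Implicit.

Theorem theorem18 (R : realType) (mu : probability (measurableTypeR R) R)
    (L alpha sigma : R)
    (mu_supp : supported_in mu `[0, L]%classic)
    (mu_mean : ('E_mu[(fun x : R => x)] = alpha%:E)%E)
    (mu_var : ('V_mu[(fun x : R => x)] = (sigma ^+ 2)%:E)%E)
    (n : nat) (n_ge1 : (1 <= n)%N) :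
  exists N : nat, forall k : nat, (N <= k)%N ->
    forall nu : probability (measurableTypeR R) R,
      is_free_mult_power mu k nu ->
      forall j : nat, (1 <= j <= n)%N -> 0 <= free_cumulant nu j.
Proof.
have L0 : 0 <= L := L_ge0 mu_supp.
have m0 : moment mu 0 = 1 := moment0 mu_supp.
have m1 : moment mu 1 = alpha := moment1_mean mu_mean.
have m2 : moment mu 2 = sigma ^+ 2 + alpha ^+ 2 := moment2_variance mu_supp mu_mean mu_var.
have a0 : 0 <= alpha by rewrite -m1 (moment_ge0 mu_supp).
(* M ^ 2 >= L holds with this M also when L < 1. *)
pose M := L + 1.
have M0 : 0 < M by rewrite /M; lra.
have mom l : moment mu l <= (M ^+ 2) ^+ l.
  apply: le_trans (moment_le mu_supp l) _.
  by rewrite lerXn2r ?nnegrE ?sqr_ge0// /M; nra.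
have [alpha0|alpha_neq0] := eqVneq alpha 0.
  exists 1%N => k k0 nu hnu j /andP[j1 _].
  rewrite alpha0 in m1.
  by rewrite (cumulants_moment0 (free_power_mean0 k0 m1 hnu)).
have alpha_gt0 : 0 < alpha by rewrite lt_def alpha_neq0.
(* Order n + 2 makes the coefficient of degree 1 available and leaves room for
   the order lost in the case sigma = 0. *)
have [|S muS] := S_transform_exists n.+1 m0; first by rewrite m1.
have [S0E S1E] := S_transform_coef m0 muS; rewrite m1 m2 in S0E S1E.
have S0 : S`_0 != 0.
  by apply/eqP => S00; move: S0E; rewrite S00 mulr0 => /eqP; rewrite eq_sym oner_eq0.
have [T ST] := mul_inverse n.+3 S0.
have STk k : S ^+ k * T ^+ k =X_n.+3 1 by rewrite -exprMn (eqX_exp k ST) expr1n.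
have Sk0 k : (S ^+ k)`_0 != 0 by rewrite -horner_coef0 horner_exp horner_coef0 expf_neq0.
have nuS k nu : (0 < k)%N -> is_free_mult_power mu k nu ->
    S_transform n.+2 (fun i => ((moment nu i)%:C)%C) (map_poly (real_complex R) (S ^+ k)).
  move=> k0 hnu; rewrite rmorphXn /=.
  exact: (S_transform_free_power M0 mom k0 (S_transform_map muS) hnu).
have concl k nu : (0 < k)%N -> is_free_mult_power mu k nu ->
    (forall j, (j < n)%N -> 0 <= (T ^+ k)`_j) ->
    forall j, (1 <= j <= n)%N -> 0 <= free_cumulant nu j.
  move=> k0 hnu Tk; have nN : (n <= n.+2)%N by lia.
  exact: (cumulants_ge0 nN (free_power_moment0 hnu) (nuS k nu k0 hnu) (Sk0 k) (STk k) Tk).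
have T0 : T`_0 = alpha.
  have := ST 0 isT; rewrite coef0M coef1 /= => e.
  by apply: (mulfI S0); rewrite e mulrC S0E.
have [sigma0|sigma_neq0] := eqVneq sigma 0.
  exists 1%N => k k0 nu hnu; apply: (concl k nu k0 hnu) => j jn.
  have mu2 : moment mu 2 = moment mu 1 ^+ 2 by rewrite m2 m1 sigma0 expr0n add0r.
  have muG := free_power_point_mass k0 m0 mu2 hnu.
  have SG := S_transform_geometric m0 muG muS; rewrite m1 in SG.
  have TG : T =X_n.+2 alpha%:P.
    have e : alpha%:P * (S * T) =X_n.+2 alpha%:P.
      by rewrite (eqXW (leqnSn _) ST) mulr1.
    by rewrite -[X in _ =X_ _ X]e mulrA mul_polyC SG mul1r.
  have jn2 : (j < n.+2)%N by lia.
  have TkG := eqX_exp k TG; rewrite (TkG j jn2) -rmorphXn coefC.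
  by case: ifP => // _; rewrite exprn_ge0.
have T1 : 0 < T`_1.
  have := ST 1%N isT; rewrite coefM !big_ord_recr big_ord0 /= add0r coef1 /= T0 => e.
  suff aT1 : alpha * T`_1 = sigma ^+ 2.
    by rewrite -(pmulr_rgt0 _ alpha_gt0) aT1 exprn_even_gt0//= sigma_neq0.
  (* The three brackets are given by the degree-one part of S T = 1, by S_1, and by
     alpha S_0 = 1. *)
  have -> : alpha * T`_1 = alpha ^+ 2 * (S`_0 * T`_1 + S`_1 * alpha) - alpha ^+ 3 * S`_1
      + alpha * T`_1 * (1 - alpha * S`_0) by ring.
  by rewrite e S1E S0E; ring.
have T0_gt0 : 0 < T`_0 by rewrite T0.
have [N hN] := powers_coefs_ge0 n T0_gt0 T1.
exists (maxn N 1) => k; rewrite geq_max => /andP[Nk k0] nu hnu.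
exact: concl k0 hnu (hN k Nk).
Qed.
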